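(* Let $\mathcal{E}$, $\mathcal{F}$ and $\mathcal{E}_k$ ($k\ge1$) be complex separable Hilbert spaces. For $k\ge 1$ let $J_k$ be the truncated shift of index $k$ on $\mathbb{E}_k=\mathcal{E}_k\otimes\mathbb{C}^k$, and let $$T=M_z^{\mathcal{E}}\oplus(M_z^{\mathcal{F}})^*\oplus\bigoplus_{k=1}^\infty J_k\quad\text{on}\quad \mathcal{H}=H^2_{\mathcal{E}}(\mathbb{D})\oplus H^2_{\mathcal{F}}(\mathbb{D})\oplus\Big(\bigoplus_{k=1}^\infty\mathbb{E}_k\Big)$$ (a completely non-unitary power partial isometry). Then the only reducing subspaces of $T$ are those of the form $$H^2_{\mathcal{E}_*}(\mathbb{D})\oplus H^2_{\mathcal{F}_*}(\mathbb{D})\oplus\Big(\bigoplus_{k=1}^\infty \mathcal{S}_k\otimes\mathbb{C}^k\Big),$$ where $\mathcal{E}_*$, $\mathcal{F}_*$ and $\mathcal{S}_k$ are closed subspaces of $\mathcal{E}$, $\mathcal{F}$ and $\mathcal{E}_k$ ($k\geq 1$), respectively; that is, a closed subspace of $\mathcal{H}$ is reducing for $T$ if and only if it is of this form.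
   Context: $H^2_{\mathcal{E}}(\mathbb{D})$ is the Hardy space of $\mathcal{E}$-valued analytic functions on the open unit disc $\mathbb{D}$, and $M_z^{\mathcal{E}}$ is multiplication by the coordinate function $z$ on $H^2_{\mathcal{E}}(\mathbb{D})$. $\mathcal{E}_k\otimes\mathbb{C}^k$ is identified with the direct sum of $k$ copies of $\mathcal{E}_k$, and $\mathcal{S}_k\otimes\mathbb{C}^k$ with the direct sum of $k$ copies of $\mathcal{S}_k$. The truncated shift of index $k$ is $J_1=0$ and, for $k\ge2$, $J_k(x_1,\ldots,x_k)=(0,x_1,\ldots,x_{k-1})$, $x_i\in\mathcal{E}_k$. A power partial isometry is an operator all of whose positive powers are partial isometries; a contraction is completely non-unitary if it has no nonzero reducing subspace on which it is unitary. A closed subspace $\mathcal{M}$ reduces $T$ if it is invariant under both $T$ and $T^*$. *)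

(* Defs.v *)
From HB Require Import structures.
From mathcomp Require Import all_boot all_order all_algebra.
From mathcomp Require Import finmap complex.
From mathcomp Require Import boolp classical_sets functions cardinality reals.
From mathcomp Require Import topology normedtype sequences summability.
From mathcomp Require Import ring.
Set Implicit Arguments.
Unset Strict Implicit.
Unset Printing Implicit Defensive.
Import Order.TTheory GRing.Theory Num.Theory.
Import numFieldNormedType.Exports.
Local Open Scope classical_set_scope.
Local Open Scope ring_scope.

(* A positive definite Hermitian form induces a norm. *)
Section DotNorm.
Variables (C : numClosedFieldType) (U : lmodType C) (form : {dot U for Num.conj}).
Implicit Types u v : U.

Definition dot_norm u : C := sqrtC (form u u).

Lemma dot_normK u : dot_norm u ^+ 2 = form u u.
Proof. exact: sqrtCK. Qed.

Lemma dot_norm_ge0 u : 0 <= dot_norm u.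
Proof. by rewrite sqrtC_ge0 dnorm_ge0. Qed.

Lemma dot_cauchy_schwarz u v : `|form u v| <= dot_norm u * dot_norm v.
Proof.
have [->|v0] := eqVneq v 0.
  by rewrite linear0r normr0 mulr_ge0// dot_norm_ge0.
have fv : 0 < form v v by rewrite dnorm_gt0.
rewrite -(@ler_pXn2r _ 2)// ?nnegrE ?mulr_ge0 ?dot_norm_ge0// exprMn !dot_normK.
pose a := form u v / form v v; pose w := u - a *: v.
have wv : form w v = 0 by rewrite linearBl/= linearZl_LR divfK ?subrr ?gt_eqF.
have -> : u = w + a *: v by rewrite subrK.
rewrite linearDl/= wv add0r linearZl_LR/= normrM (ger0_norm (ltW fv)).
rewrite exprMn hnormDd/=; last by rewrite linearZr_LR/= wv mulr0.
by rewrite dnormZ mulrDl expr2 mulrA lerDr mulr_ge0 ?dnorm_ge0.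
Qed.

Lemma dot_normD u v : dot_norm (u + v) <= dot_norm u + dot_norm v.
Proof.
rewrite -(@ler_pXn2r _ 2)// ?nnegrE ?addr_ge0 ?dot_norm_ge0//.
rewrite sqrrD !dot_normK dnormD addrAC lerD2r lerD2l.
rewrite -[leLHS](divfK (negbT (pnatr_eq0 C 2))) -ReE -[leRHS]mulr_natr ler_pM2r ?ltr0n//.
by apply: le_trans (dot_cauchy_schwarz u v); rewrite (leif_Re_Creal (form u v)).
Qed.

Lemma dot_normZ (a : C) u : dot_norm (a *: u) = `|a| * dot_norm u.
Proof.
apply/eqP; rewrite -(@eqrXn2 _ 2)// ?mulr_ge0 ?dot_norm_ge0//.
by rewrite exprMn !dot_normK dnormZ.
Qed.

Lemma dot_norm_eq0 u : dot_norm u = 0 -> u = 0.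
Proof. by move=> /eqP; rewrite sqrtC_eq0 dnorm_eq0 => /eqP. Qed.

End DotNorm.

(* R[i] carries its topology under the regular alias R[i]^o. *)
Section Complex.
Variable R : realType.
Local Notation C := R[i].

Lemma normc_ge_Im (z : C) : (`|complex.Im z|)%:C%C <= `|z|.
Proof.
by rewrite normc_def lecR -sqrtr_sqr ler_wsqrtr// lerDr sqr_ge0.
Qed.

Let subcE (a b : R) (z : C) : (a +i* b)%C - z =
  (a - complex.Re z)%:C%C + ('i%C * (b - complex.Im z)%:C%C).
Proof. by rewrite [LHS]complexE; case: z. Qed.

Let subRe (z w : C) : complex.Re (z - w) = complex.Re z - complex.Re w.
Proof. by case: z w => ? ? []. Qed.

Let subIm (z w : C) : complex.Im (z - w) = complex.Im z - complex.Im w.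
Proof. by case: z w => ? ? []. Qed.

Lemma complex_complete (F : set_system C^o) : ProperFilter F -> cauchy F -> cvg F.
Proof.
move=> FF /cauchy_ballP Fc.
have cReIm (g : C -> R) : (forall z, (`|g z|)%:C%C <= `|z|) ->
    {morph g : x y / x - y} -> cvg (g @ F).
  move=> gle gB; apply: cauchy_cvg; apply/cauchy_ballP => e e0.
  have /Fc[[A B] /= [FA FB] AB] : 0 < e%:C%C by rewrite ltcR.
  exists (g @` A, g @` B) => /=.
    by split; [apply: filterS FA|apply: filterS FB] => z ?; exists z.
  move=> [_ _] /= [[x Ax <-] [y By <-]].
  have := AB (x, y) (conj Ax By); rewrite -!ball_normE/= => xy.
  by rewrite -gB -ltcR (le_lt_trans (gle _)).
have reB : {morph (@complex.Re R) : x y / x - y} by case=> ? ? [].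
have imB : {morph (@complex.Im R) : x y / x - y} by case=> ? ? [].
have /cvg_ex[a /cvgrPdist_lt Fa] := cReIm _ (@normc_ge_Re R) reB.
have /cvg_ex[b /cvgrPdist_lt Fb] := cReIm _ normc_ge_Im imB.
apply/cvg_ex; exists (a +i* b)%C; apply/cvgrPdist_lt => /= e e_gt0.
have eE : e = (complex.Re e / 2)%:C%C + (complex.Re e / 2)%:C%C.
  by rewrite -rmorphD/= -splitr RRe_real ?gtr0_real.
have e0 : 0 < complex.Re e by move: e_gt0; rewrite ltcE => /andP[].
have e20 : 0 < complex.Re e / 2 by rewrite divr_gt0.
have {}Fa := Fa _ e20; have {}Fb := Fb _ e20; near=> z.
have za : `|a - complex.Re z| < complex.Re e / 2 by near: z.
have zb : `|b - complex.Im z| < complex.Re e / 2 by near: z.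
have -> : (a +i* b)%C - z = (a - complex.Re z)%:C%C + ('i%C * (b - complex.Im z)%:C%C) :> C.
  exact: subcE.
rewrite eE (le_lt_trans (ler_normD _ _))// normrM.
rewrite [X in _ + X * _](_ : _ = 1); last first.
  by rewrite normc_def/= expr0n/= add0r expr1n sqrtr1.
rewrite mul1r !normc_def/= expr0n/= !addr0 !sqrtr_sqr ltrD// ltcR.
Unshelve. all: by end_near. Qed.

Lemma complex_cvg_le T (F : set_system T) (f : T -> C^o) (l : C^o) (M : C) :
  ProperFilter F -> f @ F --> l -> (\forall t \near F, f t <= M) -> l <= M.
Proof.
move=> FF /cvgrPdist_lt fl fM; rewrite lecE; apply/andP; split.
  rewrite eq_sym -subr_eq0; apply/negPn/negP => d0.
  have := fl (`|complex.Im l - complex.Im M|)%:C%C.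
  rewrite ltcR normr_gt0 => /(_ d0) fl1.
  near F => t.
  have : f t <= M by near: t.
  rewrite lecE => /andP[/eqP imM _].
  have : `|l - f t| < (`|complex.Im l - complex.Im M|)%:C%C by near: t.
  by move=> /(le_lt_trans (normc_ge_Im _)); rewrite subIm imM ltxx.
rewrite leNgt -subr_gt0; apply/negP => d0.
have := fl (complex.Re l - complex.Re M)%:C%C.
rewrite ltcR => /(_ d0) fl1.
near F => t.
have : f t <= M by near: t.
rewrite lecE => /andP[_ reM].
have : `|l - f t| < (complex.Re l - complex.Re M)%:C%C by near: t.
move=> /(le_lt_trans (normc_ge_Re _)); rewrite ltcR subRe.
by move=> /(le_lt_trans (ler_norm _)); rewrite ltrD2l ltrN2 ltNge reM.
Unshelve. all: by end_near. Qed.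

Lemma complex_cvg_ge T (F : set_system T) (f : T -> C^o) (l : C^o) (M : C) :
  ProperFilter F -> f @ F --> l -> (\forall t \near F, M <= f t) -> M <= l.
Proof.
move=> FF fl fM; rewrite -lerN2; apply: complex_cvg_le (cvgN fl) _.
by near do rewrite lerN2.
Unshelve. all: by end_near. Qed.

End Complex.

Section Summability.
Variables (R : realType) (I : choiceType).
Local Notation C := R[i].
Local Open Scope fset_scope.

#[local] Instance totally_proper : ProperFilter (@totally I) := totally_filter.

Lemma partial_sum_fsetE (U : zmodType) (f : I -> U) (A : {fset I}) :
  partial_sum f A = \sum_(i <- A) f i.
Proof. by rewrite /partial_sum big_seq_fsetE. Qed.

Lemma partial_sum_sub (U : zmodType) (f : I -> U) (A B : {fset I}) :
  A `<=` B -> partial_sum f B - partial_sum f A = partial_sum f (B `\` A).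
Proof.
move=> AB; rewrite !partial_sum_fsetE (big_fsetID _ (mem A) B)/=.
have -> : [fset x in B | x \in A] = A.
  apply/fsetP => x; rewrite !inE/=; case: (boolP (x \in A)) => [/(fsubsetP AB)->//|].
  by rewrite andbF.
have -> : [fset x in B | x \notin A] = B `\` A.
  by apply/fsetP => x; rewrite !inE/= andbC.
by rewrite addrAC subrr add0r.
Qed.

Lemma ler_norm_partial_sum (E : normedModType C) (f : I -> E) (A : {fset I}) :
  `|partial_sum f A| <= partial_sum (fun i => `|f i| : C) A.
Proof. exact: ler_norm_sum. Qed.

Lemma partial_sum_ge0 (f : I -> C) (A : {fset I}) :
  (forall i, 0 <= f i) -> 0 <= partial_sum f A.
Proof. by move=> f0; rewrite sumr_ge0. Qed.

Lemma partial_sum_le (f : I -> C) (A B : {fset I}) :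
  (forall i, 0 <= f i) -> A `<=` B -> partial_sum f A <= partial_sum f B.
Proof. by move=> f0 AB; rewrite -subr_ge0 partial_sum_sub// partial_sum_ge0. Qed.

Lemma abs_summable_cvg (E : normedModType C) (f : I -> E) (M : C) :
  (forall F : set_system E, ProperFilter F -> cauchy F -> cvg F) ->
  (forall A : {fset I}, partial_sum (fun i => `|f i| : C) A <= M) ->
  cvg (partial_sum f @ totally).
Proof.
move=> Ec fM; apply: Ec; apply: cauchy_exP => e e0.
pose S (A : {fset I}) := partial_sum (fun i => `|f i| : C) A.
have S0 A : 0 <= S A by rewrite partial_sum_ge0.
pose Y := [set complex.Re (S A) | A in [set: {fset I}]]%classic.
have supY : has_sup Y.
  split; first by exists (complex.Re (S fset0)), fset0.
  exists (complex.Re M) => _ [A _ <-].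
  by have := fM A; rewrite lecE => /andP[].
have e0' : 0 < complex.Re e by move: e0; rewrite ltcE => /andP[].
have [_ [A _ <-] sA] := sup_adherent e0' supY.
exists (partial_sum f A); exists A => // B /= AB.
rewrite -ball_normE/= distrC partial_sum_sub//.
apply: le_lt_trans (ler_norm_partial_sum _ _) _; rewrite -partial_sum_sub//.
have SAB : S B - S A < e.
  rewrite -[e]RRe_real ?gtr0_real// -[S B]RRe_real ?ger0_real//.
  rewrite -[S A]RRe_real ?ger0_real// -rmorphB/= ltcR ltrBlDr.
  move: sA; rewrite ltrBlDr addrC; apply: le_lt_trans.
  by apply: sup_upper_bound => //; exists B.
exact: SAB.
Qed.

End Summability.
#[global] Existing Instance totally_proper.

HB.mixin Record NormedModule_isInner (R : realType) V & NormedModule R[i] V := {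
  inner : {dot V for Num.conj};
  inner_norm : forall x : V, inner x x = `|x| ^+ 2
}.

(* Complex Hilbert spaces; the inner product is linear in its first argument. *)
#[short(type="hilbertType")]
HB.structure Definition Hilbert (R : realType) :=
  {V of CompleteNormedModule R[i] V & NormedModule_isInner R V}.

Section HilbertTheory.
Variables (R : realType) (V : hilbertType R).

Lemma dot_norm_inner (x : V) : dot_norm inner x = `|x|.
Proof. by rewrite /dot_norm inner_norm sqrCK. Qed.

Lemma inner_cauchy_schwarz (x y : V) : `|inner x y| <= `|x| * `|y|.
Proof. by rewrite -!dot_norm_inner dot_cauchy_schwarz. Qed.

End HilbertTheory.

Section DirectSum.
Variables (R : realType) (I : choiceType).
Local Notation C := R[i].

Definition square_summable (V : I -> normedModType C) (x : forall i, V i) :=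
  exists M : C, forall A : {fset I},
    partial_sum (fun i => `|x i| ^+ 2 : C) A <= M.

Lemma square_summableD (V : I -> normedModType C) (x y : forall i, V i) :
  square_summable x -> square_summable y -> square_summable (fun i => x i + y i).
Proof.
move=> [M xM] [N yN]; exists (2 * (M + N)) => A.
apply: le_trans (_ : 2 * (partial_sum (fun i => `|x i| ^+ 2 : C) A +
                          partial_sum (fun i => `|y i| ^+ 2 : C) A) <= _).
  rewrite /partial_sum -big_split mulr_sumr/=; apply: ler_sum => i _.
  apply: le_trans (_ : (`|x (val i)| + `|y (val i)|) ^+ 2 <= _).
    by rewrite ler_pXn2r ?nnegrE ?addr_ge0// ler_normD.
  rewrite -subr_ge0; set a := `|x _|; set b := `|y _|.
  have -> : 2 * (a ^+ 2 + b ^+ 2) - (a + b) ^+ 2 = (a - b) ^+ 2.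
    by rewrite sqrrD sqrrB; ring.
  by rewrite -realEsqr rpredB// normr_real.
by rewrite ler_wpM2l// lerD.
Qed.

Lemma square_summableZ (V : I -> normedModType C) (a : C) (x : forall i, V i) :
  square_summable x -> square_summable (fun i => a *: x i).
Proof.
move=> [M xM]; exists (`|a| ^+ 2 * M) => A.
rewrite /partial_sum; under eq_bigr do rewrite normrZ exprMn.
by rewrite -mulr_sumr; apply: ler_wpM2l; [rewrite exprn_ge0|exact: xM].
Qed.

Lemma square_summableN (V : I -> normedModType C) (x : forall i, V i) :
  square_summable x -> square_summable (fun i => - x i).
Proof.
move=> [M xM]; exists M => A; rewrite /partial_sum; under eq_bigr do rewrite normrN.
exact: xM.
Qed.

Lemma square_summable0 (V : I -> normedModType C) :
  square_summable (fun i => 0 : V i).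
Proof.
exists 0 => A; rewrite /partial_sum; under eq_bigr do rewrite normr0 expr0n.
by rewrite big1.
Qed.

Variable V : I -> hilbertType R.

(* The Hilbert direct sum of the family V. The bound in square_summable is over
   all finite partial sums, and the inner product is the limit of the net of
   finite partial sums, so the index set need not be ordered or infinite. *)
Record hsum := HSum {
  hsum_fun :> forall i, V i ;
  hsumP : square_summable hsum_fun }.

HB.instance Definition _ := gen_eqMixin hsum.
HB.instance Definition _ := gen_choiceMixin hsum.

Lemma hsum_ext (x y : hsum) : (forall i, x i = y i) -> x = y.
Proof.
case: x y => [x xP] [y yP] /= xy.
have E : x = y by apply: functional_extensionality_dep.
by subst y; congr HSum; exact: Prop_irrelevance.
Qed.

Definition hsum_zero := HSum (square_summable0 V).
Definition hsum_opp (x : hsum) := HSum (square_summableN (hsumP x)).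
Definition hsum_add (x y : hsum) := HSum (square_summableD (hsumP x) (hsumP y)).
Definition hsum_scale (a : C) (x : hsum) := HSum (square_summableZ a (hsumP x)).

Let hsum_addA : associative hsum_add.
Proof. by move=> x y z; apply: hsum_ext => i /=; rewrite addrA. Qed.
Let hsum_addC : commutative hsum_add.
Proof. by move=> x y; apply: hsum_ext => i /=; rewrite addrC. Qed.
Let hsum_add0 : left_id hsum_zero hsum_add.
Proof. by move=> x; apply: hsum_ext => i /=; rewrite add0r. Qed.
Let hsum_addN : left_inverse hsum_zero hsum_opp hsum_add.
Proof. by move=> x; apply: hsum_ext => i /=; rewrite addNr. Qed.
HB.instance Definition _ :=
  GRing.isZmodule.Build hsum hsum_addA hsum_addC hsum_add0 hsum_addN.

Let hsum_scaleA a b x : hsum_scale a (hsum_scale b x) = hsum_scale (a * b) x.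
Proof. by apply: hsum_ext => i /=; rewrite scalerA. Qed.
Let hsum_scale1 : left_id 1 hsum_scale.
Proof. by move=> x; apply: hsum_ext => i /=; rewrite scale1r. Qed.
Let hsum_scaleDr : right_distributive hsum_scale +%R.
Proof. by move=> a x y; apply: hsum_ext => i /=; rewrite scalerDr. Qed.
Let hsum_scaleDl x : {morph hsum_scale^~ x : a b / a + b}.
Proof. by move=> a b; apply: hsum_ext => i /=; rewrite scalerDl. Qed.
HB.instance Definition _ := GRing.Zmodule_isLmodule.Build C hsum
  hsum_scaleA hsum_scale1 hsum_scaleDr hsum_scaleDl.

Definition hsum_inner (x y : hsum) : C :=
  @sum I C C^o (fun i => inner (x i) (y i)).


Lemma hsum_inner_cvg (x y : hsum) :
  partial_sum (fun i => inner (x i) (y i) : C^o) @ totally --> (hsum_inner x y : C^o).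
Proof.
have [[M xM] [N yN]] := (hsumP x, hsumP y).
apply: (@abs_summable_cvg _ _ C^o _ (M + N)); first exact: complex_complete.
move=> A; apply: le_trans (lerD (xM A) (yN A)).
rewrite /partial_sum -big_split/=; apply: ler_sum => i _.
apply: le_trans (inner_cauchy_schwarz _ _) _.
set a := `|x _|; set b := `|y _|.
have a0 : 0 <= a by exact: normr_ge0.
have b0 : 0 <= b by exact: normr_ge0.
rewrite -subr_ge0.
have -> : a ^+ 2 + b ^+ 2 - a * b = (a - b) ^+ 2 + a * b by rewrite sqrrB; ring.
apply: addr_ge0; last exact: mulr_ge0.
by rewrite -realEsqr rpredB// ger0_real.
Qed.

Lemma hsum_innerE (x y : hsum) (l : C) :
  partial_sum (fun i => inner (x i) (y i) : C^o) @ totally --> (l : C^o) ->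
  hsum_inner x y = l.
Proof. exact: cvg_lim. Qed.

End DirectSum.
Arguments hsum_inner_cvg {R I V} x y.

Section DirectSumHilbert.
Variables (R : realType) (I : choiceType) (V : I -> hilbertType R).
Local Notation C := R[i].
Local Notation H := (hsum V).

Let hsum_inner_linearl (z : H) (a : C) (x y : H) :
  hsum_inner (a *: x + y) z = a * hsum_inner x z + hsum_inner y z.
Proof.
apply: hsum_innerE.
have -> : partial_sum (fun i => inner ((a *: x + y) i) (z i) : C^o) =
    (a \*: (partial_sum (fun i => inner (x i) (z i) : C^o)) \+
    partial_sum (fun i => inner (y i) (z i) : C^o)).
  apply/funext => A /=; rewrite /partial_sum scaler_sumr -big_split/=.
  by apply: eq_bigr => i _; rewrite linearDl linearZl_LR.
by apply: cvgD; [apply: cvgZl_tmp|]; exact: hsum_inner_cvg.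
Qed.

Let hsum_inner_conj (x y : H) : hsum_inner x y = (hsum_inner y x)^*.
Proof.
apply: hsum_innerE; apply/cvgrPdist_lt => e e0.
have /cvgrPdist_lt/(_ e e0) := hsum_inner_cvg y x.
apply: filterS => A /=; rewrite -norm_conjC rmorphB/= /partial_sum rmorph_sum/=.
suff -> : \sum_(i : A) (inner (y (val i)) (x (val i)))^* =
    \sum_(i : A) inner (x (val i)) (y (val i)) by [].
by apply: eq_bigr => i _; rewrite [RHS]hermC/= expr0 mul1r.
Qed.

Let hsum_inner_linearr (z : H) (a : C) (x y : H) :
  hsum_inner z (a *: x + y) = a^* * hsum_inner z x + hsum_inner z y.
Proof.
by rewrite !(hsum_inner_conj z) hsum_inner_linearl rmorphD rmorphM.
Qed.

Let partial_sum_inner (x : H) (A : {fset I}) :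
  partial_sum (fun i => inner (x i) (x i) : C^o) A =
  partial_sum (fun i => `|x i| ^+ 2 : C) A.
Proof. by apply: eq_bigr => i _; exact: inner_norm. Qed.

Lemma hsum_inner_ge (x : H) (A : {fset I}) :
  partial_sum (fun i => `|x i| ^+ 2 : C) A <= hsum_inner x x.
Proof.
apply: complex_cvg_ge (hsum_inner_cvg x x) _.
exists A => // B /= AB; rewrite partial_sum_inner.
by apply: partial_sum_le => // i; rewrite exprn_ge0.
Qed.

Lemma hsum_inner_le (x : H) (M : C) :
  (forall A : {fset I}, partial_sum (fun i => `|x i| ^+ 2 : C) A <= M) ->
  hsum_inner x x <= M.
Proof.
move=> xM; apply: complex_cvg_le (hsum_inner_cvg x x) _.
by exists fset0 => // A _ /=; rewrite partial_sum_inner; exact: xM.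
Qed.

Let norm_le_inner (x : H) i : `|x i| ^+ 2 <= hsum_inner x x.
Proof.
apply: le_trans (hsum_inner_ge x [fset i]%fset).
by rewrite partial_sum_fsetE big_seq_fset1.
Qed.

Let hsum_inner_gt0 (x : H) : x != 0 -> 0 < hsum_inner x x.
Proof.
move=> x0; have [i xi0] : exists i, x i != 0.
  apply/not_existsP => h; move/eqP: x0; apply; apply: hsum_ext => i.
  by have /negP/negPn/eqP := h i.
by apply: lt_le_trans (norm_le_inner x i); rewrite exprn_gt0// normr_gt0.
Qed.

Let hsum_bilinear : bilinear_for
  (GRing.Scale.Law.clone _ _ ( *%R : C -> C -> C) _)
  (GRing.Scale.Law.clone _ _ ((Num.conj : C -> C) \; *%R) _)
  (@hsum_inner _ _ V : H -> H -> C).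
Proof.
split => [z a x y|z a x y] /=.
  exact: hsum_inner_linearl.
exact: hsum_inner_linearr.
Qed.

HB.instance Definition _ := bilinear_isBilinear.Build C H H C
  (GRing.Scale.Law.clone _ _ ( *%R : C -> C -> C) _)
  (GRing.Scale.Law.clone _ _ ((Num.conj : C -> C) \; *%R) _)
  (@hsum_inner _ _ V : H -> H -> C) hsum_bilinear.
Let hsum_hermitian (x y : H) :
  hsum_inner x y = (-1) ^+ false * (hsum_inner y x)^*.
Proof. by rewrite expr0 mul1r. Qed.
HB.instance Definition _ := isHermitianSesquilinear.Build C H false Num.conj
  (@hsum_inner _ _ V) hsum_hermitian.
HB.instance Definition _ := isDotProduct.Build C H (@hsum_inner _ _ V)
  hsum_inner_gt0.

Definition hsum_dot : {dot H for Num.conj} := @hsum_inner _ _ V.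

HB.instance Definition _ := Lmodule_isNormed.Build C H
  (dot_normD hsum_dot) (dot_normZ hsum_dot) (@dot_norm_eq0 _ _ hsum_dot).

End DirectSumHilbert.

Section Completeness.
Variables (R : realType).
Local Notation C := R[i].

Lemma cauchy_nonexpansive (U W : normedModType C) (g : U -> W) (F : set_system U) :
  Filter F -> (forall x y, `|g x - g y| <= `|x - y|) -> cauchy F -> cauchy (g @ F).
Proof.
move=> FF gle /cauchy_ballP Fc; apply/cauchy_ballP => e e0.
have [[A B] /= [FA FB] AB] := Fc _ e0.
exists (g @` A, g @` B) => /=.
  by split; [apply: filterS FA|apply: filterS FB] => z ?; exists z.
move=> [_ _] /= [[x Ax <-] [y By <-]].
have := AB (x, y) (conj Ax By); rewrite -!ball_normE/=.
by apply: le_lt_trans; exact: gle.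
Qed.

Variables (I : choiceType) (V : I -> hilbertType R).
Local Notation H := (hsum V).

Lemma hsum_normE (x : H) : `|x| ^+ 2 = hsum_inner x x.
Proof. by rewrite -(dot_normK (hsum_dot V)). Qed.

Lemma hsum_norm_ge (x : H) (A : {fset I}) :
  partial_sum (fun i => `|x i| ^+ 2 : C) A <= `|x| ^+ 2.
Proof. by rewrite hsum_normE; exact: hsum_inner_ge. Qed.

Lemma hsum_norm_le (x : H) (e : C) : 0 <= e ->
  (forall A : {fset I}, partial_sum (fun i => `|x i| ^+ 2 : C) A <= e ^+ 2) ->
  `|x| <= e.
Proof.
move=> e0 xe; rewrite -(@ler_pXn2r _ 2)// ?nnegrE// hsum_normE.
exact: hsum_inner_le.
Qed.

Lemma hsum_coord_le (x : H) i : `|x i| <= `|x|.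
Proof.
rewrite -(@ler_pXn2r _ 2)// ?nnegrE//.
apply: le_trans (hsum_norm_ge x [fset i]%fset).
by rewrite partial_sum_fsetE big_seq_fset1.
Qed.

Let hsum_complete (F : set_system H) : ProperFilter F -> cauchy F -> cvg F.
Proof.
move=> FF Fc.
have cvi i : cvg ((fun x : H => x i) @ F).
  apply: cauchy_cvg; apply: cauchy_nonexpansive Fc => x y.
  exact: (hsum_coord_le (x - y)).
pose y i : V i := lim ((fun x : H => x i) @ F).
have key (e : C) : 0 < e -> exists2 u : H, F (ball u e) &
    forall A : {fset I}, partial_sum (fun i => `|u i - y i| ^+ 2 : C) A <= e ^+ 2.
  move=> e0; have /cauchyP/(_ e e0)[u Fu] := Fc; exists u => // A.
  apply: (@complex_cvg_le R H F
    (fun w : H => partial_sum (fun i => `|u i - w i| ^+ 2 : C) A)).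
    rewrite /partial_sum; apply: cvg_big => [|i _]; first exact: add_continuous.
    rewrite expr2; under eq_fun do rewrite expr2.
    have h : (fun w : H => `|u (val i) - w (val i)| : C^o) @ F -->
        (`|u (val i) - y (val i)| : C^o).
      by apply: cvg_norm; apply: cvgB; [exact: cvg_cst|exact: cvi].
    exact: cvgM.
  apply: filterS Fu => w; rewrite -ball_normE/= => uw.
  apply: le_trans (hsum_norm_ge (u - w) A) _.
  by apply: lerXn2r; rewrite ?nnegrE//; exact: ltW.
have ssy : square_summable y.
  have [u _ uy] := key 1 ltr01.
  have uyS : square_summable (fun i => u i - y i) by exists (1 ^+ 2).
  have := square_summableD (hsumP u) (square_summableN uyS).
  by congr square_summable; apply: functional_extensionality_dep => i;
    rewrite opprB addrC subrK.
apply/cvg_ex; exists (HSum ssy); apply/cvgrPdist_lt => e e0.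
have e20 : 0 < e / 2 by rewrite divr_gt0.
have [u Fu uy] := key _ e20; apply: filterS Fu => w.
rewrite -ball_normE/= => uw; rewrite [e]splitr.
apply: le_lt_trans (ler_distD u _ _) _; apply: ler_ltD => //.
rewrite distrC; apply: hsum_norm_le; first exact: ltW.
exact: uy.
Qed.

HB.instance Definition _ := Uniform_isComplete.Build H hsum_complete.

Let hsum_inner_norm (x : H) : hsum_dot V x x = `|x| ^+ 2.
Proof. by rewrite -(dot_normK (hsum_dot V)). Qed.
HB.instance Definition _ :=
  NormedModule_isInner.Build R H hsum_inner_norm.


End Completeness.

Section PowerSeries.
Variable R : realType.
Local Notation C := R[i].

Definition initial (n : nat) : {fset nat} := [fset i in iota 0 n]%fset.

Lemma partial_sum_initial (U : zmodType) (f : nat -> U) n :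
  partial_sum f (initial n) = series f n.
Proof.
rewrite partial_sum_fsetE /series/= /index_iota subn0.
apply: perm_big; apply: uniq_perm; rewrite ?fset_uniq ?iota_uniq// => i.
by rewrite !inE.
Qed.

Lemma sub_initial (A : {fset nat}) n :
  (\max_(i <- A) i < n)%N -> (A `<=` initial n)%fset.
Proof.
move=> An; apply/fsubsetP => i iA; rewrite !inE/= mem_iota leq0n add0n/=.
by apply: leq_ltn_trans An; apply: (@leq_bigmax_seq _ _ xpredT id).
Qed.

Lemma cvg_initial : initial @ \oo --> totally.
Proof.
move=> P [A _ AP]; exists (\max_(i <- A) i).+1 => // n /= An.
by apply: AP; exact: sub_initial.
Qed.

Lemma partial_sum_geometric (r : C) (A : {fset nat}) : 0 <= r -> r < 1 ->
  partial_sum (fun n => r ^+ n) A <= (1 - r)^-1.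
Proof.
move=> r0 r1; have r1' : 0 < 1 - r by rewrite subr_gt0.
apply: le_trans (partial_sum_le _ (sub_initial (ltnSn _))) _.
  by move=> i; rewrite exprn_ge0.
rewrite partial_sum_initial /series/= big_mkord.
rewrite -[_^-1]mul1r ler_pdivlMr// mulrC -opprB mulNr -subrX1 opprB.
by rewrite gerBl exprn_ge0.
Qed.

Variable E : hilbertType R.
Implicit Types a b : nat -> E.

Let V (_ : nat) : normedModType C := E.

Lemma square_summable_bounded a : @square_summable R nat V a ->
  exists2 K : C, 0 <= K & forall n, `|a n| <= K.
Proof.
move=> [M aM].
have aM1 n : `|a n| ^+ 2 <= M.
  by have := aM [fset n]%fset; rewrite partial_sum_fsetE big_seq_fset1.
have M0 : 0 <= M by apply: le_trans (aM1 0); rewrite exprn_ge0.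
exists (sqrtC M); first by rewrite sqrtC_ge0.
by move=> n; rewrite -(@ler_pXn2r _ 2)// ?nnegrE ?sqrtC_ge0// sqrtCK.
Qed.

Lemma power_series_cvg a (z : C) : @square_summable R nat V a -> `|z| < 1 ->
  cvg (series (fun n => z ^+ n *: a n) @ \oo).
Proof.
move=> /square_summable_bounded[K K0 aK] z1.
have : cvg (partial_sum (fun n => z ^+ n *: a n) @ totally).
  apply: (@abs_summable_cvg _ _ _ _ ((1 - `|z|)^-1 * K)).
    by move=> F FF; exact: cauchy_cvg.
  move=> A; apply: le_trans (_ : partial_sum (fun n => `|z| ^+ n) A * K <= _).
    rewrite /partial_sum mulr_suml; apply: ler_sum => i _.
    by rewrite normrZ normrX ler_wpM2l// exprn_ge0.
  by rewrite ler_wpM2r// partial_sum_geometric.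
move=> /cvg_ex[l lE]; apply/cvg_ex; exists l.
rewrite -(_ : partial_sum (fun n => z ^+ n *: a n) \o initial =
  series (fun n => z ^+ n *: a n)); last first.
  by apply/funext => n /=; rewrite partial_sum_initial.
exact: cvg_comp cvg_initial lE.
Qed.

Let shift_bound a (K : C) m (z : C) N : 0 <= K -> (forall n, `|a n| <= K) ->
    (forall j, (j < m)%N -> a j = 0) -> z != 0 -> `|z| < 1 -> (m < N)%N ->
  `|a m| <= `|series (fun n => z ^+ n *: a n) N| / `|z| ^+ m
    + `|z| * ((1 - `|z|)^-1 * K).
Proof.
move=> K0 aK am0 z0 z1 mN.
have nz : 0 < `|z| ^+ m by rewrite exprn_gt0// normr_gt0.
rewrite -(ler_pM2l nz) mulrDr mulrCA divff ?gt_eqF// mulr1.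
rewrite -normrX -normrZ.
have sE : series (fun n => z ^+ n *: a n) N =
    z ^+ m *: a m + \sum_(m.+1 <= n < N) z ^+ n *: a n.
  rewrite /series/= (@big_cat_nat _ _ _ m)//= ?(ltnW mN)// big_nat big1 ?add0r.
    by rewrite big_ltn.
  by move=> i /andP[_ im]; rewrite am0// scaler0.
rewrite [X in `|X| <= _](_ : _ = series (fun n => z ^+ n *: a n) N -
    \sum_(m.+1 <= n < N) z ^+ n *: a n); last by rewrite sE addrK.
apply: le_trans (ler_normB _ _) _; rewrite lerD2l.
apply: le_trans (ler_norm_sum _ _ _) _.
apply: le_trans (_ : \sum_(m.+1 <= n < N) `|z| ^+ n * K <= _).
  by apply: ler_sum => n _; rewrite normrZ normrX ler_wpM2l// exprn_ge0.
rewrite -mulr_suml !mulrA ler_wpM2r//.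
rewrite -{1}(add0n m.+1) big_addn big_mkord.
under eq_bigr do rewrite exprD.
rewrite -mulr_suml mulrC normrX -exprSr ler_wpM2l ?exprn_ge0//.
rewrite -(@big_mkord _ _ _ _ xpredT (fun n => `|z| ^+ n)).
have := @partial_sum_geometric `|z| (initial (N - m.+1)) (normr_ge0 z) z1.
by rewrite partial_sum_initial.
Qed.

Lemma power_series_inj a b :
  @square_summable R nat V a -> @square_summable R nat V b ->
  (forall z : C, `|z| < 1 -> exists l : E,
     series (fun n => z ^+ n *: a n) @ \oo --> l /\
     series (fun n => z ^+ n *: b n) @ \oo --> l) -> forall n, a n = b n.
Proof.
move=> aS bS ab; pose c n := a n - b n.
have [K K0 cK] : exists2 K : C, 0 <= K & forall n, `|c n| <= K.
  exact: square_summable_bounded (square_summableD aS (square_summableN bS)).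
have c0 z : `|z| < 1 -> series (fun n => z ^+ n *: c n) @ \oo --> (0 : E).
  move=> /ab[l [al bl]].
  rewrite -(subrr l) (_ : series _ = series (fun n => z ^+ n *: a n) -
    series (fun n => z ^+ n *: b n)); first exact: cvgB.
  by apply/funext => n; rewrite /series/= fctE/= -sumrB;
    apply: eq_bigr => i _; rewrite scalerBr.
suff c_eq0 n : c n = 0 by move=> n; apply/eqP; rewrite -subr_eq0 -/(c n) c_eq0.
have [m] := ubnP n; elim: m n => // m IH n nm.
have cn0 j : (j < n)%N -> c j = 0 by move=> jn; apply: IH; exact: leq_trans jn _.
have bound (z : C) : z != 0 -> `|z| < 1 ->
    `|c n| <= `|z| * ((1 - `|z|)^-1 * K).
  move=> z0 z1.
  have h : (fun N => `|series (fun k => z ^+ k *: c k) N| / `|z| ^+ n +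
      `|z| * ((1 - `|z|)^-1 * K) : C^o) @ \oo -->
      (`|0 : E| / `|z| ^+ n + `|z| * ((1 - `|z|)^-1 * K) : C^o).
    apply: cvgD; last exact: cvg_cst.
    by apply: cvgMr_tmp; apply: cvg_norm; exact: c0.
  rewrite normr0 mul0r add0r in h.
  apply: complex_cvg_ge h _; exists n.+1 => // N /= nN.
  exact: shift_bound.
apply/eqP; rewrite -normr_le0; apply/negPn/negP => cn.
have cn_gt0 : 0 < `|c n| by rewrite normr_gt0; apply: contra cn => /eqP->; rewrite normr0.
have K_gt0 : 0 < K by exact: lt_le_trans cn_gt0 (cK n).
pose r : C := `|c n| / (4 * K).
have r_gt0 : 0 < r by rewrite divr_gt0// mulr_gt0.
have r_le : r <= 4^-1.
  by rewrite /r invfM mulrCA ger_pMr ?invr_gt0// ler_pdivrMr// mul1r.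
have r12 : 2^-1 <= 1 - r.
  have -> : 2^-1 = 1 - 2^-1 :> C by rewrite [X in X - _](splitr 1) div1r addrK.
  rewrite lerD2l lerN2; apply: le_trans r_le _.
  by rewrite lef_pV2 ?posrE ?ltr0n// ler_nat.
have r1 : r < 1 by rewrite -subr_gt0; apply: lt_le_trans r12; rewrite invr_gt0.
have r_neq0 : r != 0 by rewrite gt_eqF.
have := bound r r_neq0; rewrite ger0_norm ?(ltW r_gt0)// => /(_ r1) cr.
have : `|c n| <= `|c n| / 2.
  apply: le_trans cr _; apply: le_trans (_ : r * (2 * K) <= _).
    rewrite ler_wpM2l ?(ltW r_gt0)// ler_wpM2r// -[leRHS]invrK.
    by rewrite lef_pV2 ?posrE ?invr_gt0// subr_gt0.
  have K_neq0 : K != 0 by rewrite gt_eqF.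
  by rewrite le_eqVlt; apply/orP; left; apply/eqP; rewrite /r; field.
by rewrite ler_pdivlMr// ger_pMr// (ler_nat C 2 1).
Qed.

End PowerSeries.

Definition disc (R : realType) := {z : R[i] | `|z| < 1}.

Section Hardy.
Variables (R : realType) (E : hilbertType R).
Local Notation C := R[i].
Local Notation l2 := (hsum (fun _ : nat => E)).

Definition power_series_of (f : disc R -> E) (a : l2) :=
  forall z : disc R, series (fun n => val z ^+ n *: a n) @ \oo --> f z.

(* The Hardy space H^2_E(D): functions f : D -> E with f z = \sum_n z^n a_n on D
   and \sum_n |a_n|^2 finite. Its inner product is that of the coefficient
   sequences, which f determines uniquely (taylor_unique). *)
Record hardy := Hardy {
  hardy_fun :> disc R -> E ;
  hardyP : exists a : l2, power_series_of hardy_fun a }.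

HB.instance Definition _ := gen_eqMixin hardy.
HB.instance Definition _ := gen_choiceMixin hardy.

Lemma hardy_ext (f g : hardy) : (forall z, f z = g z) -> f = g.
Proof.
case: f g => [f fP] [g gP] /= fg.
have e : f = g by apply/funext.
by subst g; congr Hardy; exact: Prop_irrelevance.
Qed.

Definition taylor (f : hardy) : l2 := sval (cid (hardyP f)).

Lemma taylorP (f : hardy) : power_series_of f (taylor f).
Proof. by rewrite /taylor; case: cid. Qed.
Arguments taylorP : clear implicits.

Lemma taylor_unique (f : hardy) (a : l2) : power_series_of f a -> taylor f = a.
Proof.
move=> fa; apply: hsum_ext; apply: power_series_inj; try exact: hsumP.
by move=> z z1; exists (f (exist _ z z1)); split; [exact: taylorP|exact: fa].
Qed.

Lemma power_series_ofD f g a b : power_series_of f a ->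
  power_series_of g b -> power_series_of (f \+ g) (a + b).
Proof.
move=> fa gb z.
rewrite (_ : series _ = series (fun n => val z ^+ n *: a n) +
    series (fun n => val z ^+ n *: b n)); first exact: cvgD (fa z) (gb z).
apply/funext => N; rewrite /series/= fctE/= -big_split/=.
by apply: eq_bigr => n _; rewrite scalerDr.
Qed.

Lemma power_series_ofZ f a (k : C) : power_series_of f a ->
  power_series_of (k \*: f) (k *: a).
Proof.
move=> fa z; rewrite (_ : series _ = k \*: series (fun n => val z ^+ n *: a n)).
  by apply: cvgZl_tmp; exact: fa.
apply/funext => N; rewrite /series/= scaler_sumr.
by apply: eq_bigr => n _; rewrite !scalerA mulrC.
Qed.

Lemma power_series_of0 : power_series_of (fun=> 0) 0.
Proof.
move=> z; rewrite (_ : series _ = fun=> 0); first exact: cvg_cst.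
by apply/funext => N; rewrite /series/= big1// => n _; rewrite scaler0.
Qed.

Lemma power_series_ofN f a : power_series_of f a -> power_series_of (\- f) (- a).
Proof.
rewrite (_ : \- f = -1 \*: f); last by apply/funext => z /=; rewrite scaleN1r.
by rewrite -[- a]scaleN1r; exact: power_series_ofZ.
Qed.

Definition hardy_zero : hardy := Hardy (ex_intro _ 0 power_series_of0).
Definition hardy_opp (f : hardy) : hardy :=
  Hardy (ex_intro _ _ (power_series_ofN (taylorP f))).
Definition hardy_add (f g : hardy) : hardy :=
  Hardy (ex_intro _ _ (power_series_ofD (taylorP f) (taylorP g))).
Definition hardy_scale (k : C) (f : hardy) : hardy :=
  Hardy (ex_intro _ _ (power_series_ofZ (k := k) (taylorP f))).

Let hardy_addA : associative hardy_add.
Proof. by move=> f g h; apply: hardy_ext => z /=; rewrite addrA. Qed.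
Let hardy_addC : commutative hardy_add.
Proof. by move=> f g; apply: hardy_ext => z /=; rewrite addrC. Qed.
Let hardy_add0 : left_id hardy_zero hardy_add.
Proof. by move=> f; apply: hardy_ext => z /=; rewrite add0r. Qed.
Let hardy_addN : left_inverse hardy_zero hardy_opp hardy_add.
Proof. by move=> f; apply: hardy_ext => z /=; rewrite addNr. Qed.
HB.instance Definition _ :=
  GRing.isZmodule.Build hardy hardy_addA hardy_addC hardy_add0 hardy_addN.

Let hardy_scaleA a b f : hardy_scale a (hardy_scale b f) = hardy_scale (a * b) f.
Proof. by apply: hardy_ext => z /=; rewrite scalerA. Qed.
Let hardy_scale1 : left_id 1 hardy_scale.
Proof. by move=> f; apply: hardy_ext => z /=; rewrite scale1r. Qed.
Let hardy_scaleDr : right_distributive hardy_scale +%R.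
Proof. by move=> k f g; apply: hardy_ext => z /=; rewrite scalerDr. Qed.
Let hardy_scaleDl f : {morph hardy_scale^~ f : a b / a + b}.
Proof. by move=> a b; apply: hardy_ext => z /=; rewrite scalerDl. Qed.
HB.instance Definition _ := GRing.Zmodule_isLmodule.Build C hardy
  hardy_scaleA hardy_scale1 hardy_scaleDr hardy_scaleDl.

Lemma taylor_is_linear : linear taylor.
Proof.
move=> k f g; apply: taylor_unique.
exact: power_series_ofD (power_series_ofZ (k := k) (taylorP f)) (taylorP g).
Qed.
HB.instance Definition _ :=
  GRing.isLinear.Build C hardy l2 *:%R taylor taylor_is_linear.

Lemma taylor_inj : injective taylor.
Proof.
move=> f g fg; apply: hardy_ext => z.
have fz := taylorP f z; have gz := taylorP g z; rewrite fg in fz.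
exact: cvg_unique fz gz.
Qed.

Lemma hardy_of_subproof (a : l2) :
  exists b : l2, power_series_of
    (fun z => lim (series (fun n => val z ^+ n *: a n) @ \oo)) b.
Proof. by exists a => z; apply: power_series_cvg (valP z); exact: hsumP. Qed.

Definition hardy_of (a : l2) : hardy := Hardy (hardy_of_subproof a).

Lemma hardy_ofK : cancel hardy_of taylor.
Proof.
move=> a; apply: taylor_unique => z.
by apply: power_series_cvg (valP z); exact: hsumP.
Qed.

Definition hardy_inner (f g : hardy) : C := hsum_inner (taylor f) (taylor g).

Let hardy_bilinear : bilinear_for
  (GRing.Scale.Law.clone _ _ ( *%R : C -> C -> C) _)
  (GRing.Scale.Law.clone _ _ ((Num.conj : C -> C) \; *%R) _)
  (hardy_inner : hardy -> hardy -> C).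
Proof.
split => [z a x y|z a x y] /=; rewrite /hardy_inner linearP.
  by rewrite linearDl linearZl_LR.
by rewrite linearDr linearZr_LR.
Qed.
HB.instance Definition _ := bilinear_isBilinear.Build C hardy hardy C
  (GRing.Scale.Law.clone _ _ ( *%R : C -> C -> C) _)
  (GRing.Scale.Law.clone _ _ ((Num.conj : C -> C) \; *%R) _)
  hardy_inner hardy_bilinear.

Let hardy_hermitian (f g : hardy) :
  hardy_inner f g = (-1) ^+ false * (hardy_inner g f)^*.
Proof. exact: hermC. Qed.
HB.instance Definition _ := isHermitianSesquilinear.Build C hardy false Num.conj
  hardy_inner hardy_hermitian.

Let hardy_inner_gt0 (f : hardy) : f != 0 -> 0 < hardy_inner f f.
Proof.
move=> f0; rewrite dnorm_gt0; apply: contra f0 => /eqP f0; apply/eqP.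
by apply: taylor_inj; rewrite f0 linear0.
Qed.
HB.instance Definition _ := isDotProduct.Build C hardy hardy_inner hardy_inner_gt0.

Definition hardy_dot : {dot hardy for Num.conj} := hardy_inner.

HB.instance Definition _ := Lmodule_isNormed.Build C hardy
  (dot_normD hardy_dot) (dot_normZ hardy_dot) (@dot_norm_eq0 _ _ hardy_dot).

Lemma norm_taylor (f : hardy) : `|taylor f| = `|f|.
Proof. by []. Qed.

Let hardy_complete (F : set_system hardy) : ProperFilter F -> cauchy F -> cvg F.
Proof.
move=> FF Fc.
have /cauchy_cvg/cvg_ex[a aE] : cauchy (taylor @ F).
  by apply: cauchy_nonexpansive Fc => f g; rewrite -linearB norm_taylor.
apply/cvg_ex; exists (hardy_of a); apply/cvgrPdist_lt => e e0.
move/cvgrPdist_lt : aE => /(_ e e0); apply: filterS => f /=.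
by rewrite -norm_taylor linearB/= hardy_ofK.
Qed.
HB.instance Definition _ := Uniform_isComplete.Build hardy hardy_complete.

Let hardy_inner_norm (f : hardy) : hardy_dot f f = `|f| ^+ 2.
Proof. by rewrite -(dot_normK hardy_dot). Qed.
HB.instance Definition _ :=
  NormedModule_isInner.Build R hardy hardy_inner_norm.


End Hardy.
Arguments taylorP {R E} f z.

Section MultiplicationByZ.
Variables (R : realType) (E : hilbertType R).
Local Notation C := R[i].
Local Notation l2 := (hsum (fun _ : nat => E)).

Lemma shift_square_summable (a : l2) :
  @square_summable R nat (fun=> E) (fun n => if n is m.+1 then a m else 0).
Proof.
have [M aM] := hsumP a; exists M => A; pose N := \max_(i <- A) i.
have AN : (A `<=` initial N.+1)%fset by exact: sub_initial.
apply: le_trans (partial_sum_le _ AN) _ => [i|]; first by rewrite exprn_ge0.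
rewrite partial_sum_initial /series/= big_nat_recl//= normr0 expr0n add0r.
by have := aM (initial N); rewrite partial_sum_initial.
Qed.

Definition shift (a : l2) : l2 := HSum (shift_square_summable a).

Lemma power_series_of_shift (f : disc R -> E) (a : l2) :
  power_series_of f a -> power_series_of (fun z => val z *: f z) (shift a).
Proof.
move=> fa z; rewrite -cvg_shiftS.
rewrite (_ : (fun n => _) = val z \*: series (fun n => val z ^+ n *: a n)).
  by apply: cvgZl_tmp; exact: fa.
apply/funext => N; rewrite /series/= big_nat_recl//= scaler0 add0r scaler_sumr.
by apply: eq_bigr => n _; rewrite scalerA exprS.
Qed.

Definition mulz (f : hardy E) : hardy E :=
  Hardy (ex_intro _ _ (power_series_of_shift (taylorP f))).

End MultiplicationByZ.

Section Operators.
Variable R : realType.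
Local Notation C := R[i].

Lemma hsum_op_subproof (I : choiceType) (V : I -> hilbertType R)
    (A : forall i, V i -> V i) : (forall i x, `|A i x| <= `|x|) ->
  forall x : hsum V, square_summable (fun i => A i (x i)).
Proof.
move=> A1 x; have [M xM] := hsumP x; exists M => B.
apply: le_trans (xM B); apply: ler_sum => i _.
by apply: lerXn2r; rewrite ?nnegrE//; exact: A1.
Qed.

(* The direct sum of a family of contractions. *)
Definition hsum_op (I : choiceType) (V : I -> hilbertType R)
    (A : forall i, V i -> V i) (A1 : forall i x, `|A i x| <= `|x|)
    (x : hsum V) : hsum V :=
  HSum (hsum_op_subproof A1 x).

Lemma partial_sum_fin (I : finType) (f : I -> C) :
  partial_sum f [fset i in I]%fset = \sum_i f i.
Proof.
by rewrite partial_sum_fsetE big_imfset//= big_enum.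
Qed.

Lemma partial_sum_fin_le (I : finType) (f : I -> C) (A : {fset I}) :
  (forall i, 0 <= f i) -> partial_sum f A <= \sum_i f i.
Proof.
move=> f0; rewrite -partial_sum_fin; apply: partial_sum_le => //.
by apply/fsubsetP => i _; rewrite !inE.
Qed.

Lemma square_summable_fin (I : finType) (V : I -> hilbertType R)
  (x : forall i, V i) : square_summable x.
Proof.
by exists (\sum_i `|x i| ^+ 2) => A; apply: partial_sum_fin_le => i; rewrite exprn_ge0.
Qed.

Definition hsum_fin (I : finType) (V : I -> hilbertType R) (x : forall i, V i) :
  hsum V := HSum (square_summable_fin x).

(* The direct sum of two spaces; true indexes the first summand. *)
Definition dsum_family (U W : hilbertType R) (b : bool) : hilbertType R :=
  if b then U else W.
Definition dsum (U W : hilbertType R) : hilbertType R := hsum (dsum_family U W).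

Definition dsum_op (U W : hilbertType R) (A : U -> U) (B : W -> W)
    (h : dsum U W) : dsum U W :=
  hsum_fin (fun b => if b return dsum_family U W b
                     then A (h true) else B (h false)).

(* E tensor C^k, as the direct sum of k copies of E. *)
Definition copies (E : hilbertType R) (k : nat) : hilbertType R :=
  hsum (fun _ : 'I_k => E).

(* (x_0, ..., x_(k-1)) |-> (0, x_0, ..., x_(k-2)); it is 0 for k = 1. *)
Definition truncated_shift (E : hilbertType R) (k : nat) (x : copies E k) :
    copies E k :=
  hsum_fin (fun i : 'I_k => if i == 0%N :> nat then 0 : E else x (ord_pred i)).

Lemma truncated_shift_contraction (E : hilbertType R) (k : nat) (x : copies E k) :
  `|truncated_shift x| <= `|x|.
Proof.
apply: hsum_norm_le => // A; apply: le_trans (hsum_norm_ge x [fset i in 'I_k]%fset).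
rewrite partial_sum_fin; apply: le_trans (partial_sum_fin_le _ _) _.
  by move=> i; rewrite exprn_ge0.
case: k x {A} => [|k] x; first by rewrite !big_ord0.
rewrite big_ord_recl big_ord_recr/= normr0 expr0n add0r.
set s := (X in X <= _); have -> : s = \sum_(i < k) `|x (widen_ord (leqnSn k) i)| ^+ 2.
  apply: eq_bigr => i _ /=; congr (`|x _| ^+ 2); apply: val_inj => /=.
  by rewrite /bump/= add0n modnDr modn_small// ltnS ltnW.
by rewrite lerDl exprn_ge0.
Qed.

End Operators.

Section ReducingSubspaces.
Variable R : realType.

Definition separable (T : topologicalType) :=
  exists2 D : set T, countable D & dense D.

(* The default value is never reached for a bounded linear operator A. *)
Definition adjoint (V : hilbertType R) (A : V -> V) : V -> V :=
  xget (fun=> 0) [set B | forall x y, inner (A x) y = inner x (B y)].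

Definition closed_subspace (V : hilbertType R) (M : set V) :=
  [/\ closed M, M 0, (forall x y, M x -> M y -> M (x + y))
    & (forall (a : R[i]) x, M x -> M (a *: x))].

Definition reducing_subspace (V : hilbertType R) (A : V -> V) (M : set V) :=
  [/\ closed_subspace M, (forall x, M x -> M (A x))
    & (forall x, M x -> M (adjoint A x))].

(* H^2_S(D) inside H^2_E(D): the S-valued functions. *)
Definition hardy_sub (E : hilbertType R) (S : set E) : set (hardy E) :=
  [set f | forall z, S (f z)].

(* For a constant family S : set E indexed by 'I_k, this is S tensor C^k. *)
Definition hsum_sub (I : choiceType) (V : I -> hilbertType R)
    (S : forall i, set (V i)) : set (hsum V) :=
  [set x | forall i, S i (x i)].

Definition dsum_sub (U W : hilbertType R) (S : set U) (T : set W) :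
    set (dsum U W) :=
  [set h : dsum U W | S (h true) /\ T (h false)].

(* The index k : nat stands for k + 1: G k is the space E_(k+1), which occurs
   with multiplicity k + 1. *)
Definition truncated_shifts (G : nat -> hilbertType R) :=
  hsum_op (fun k x => @truncated_shift_contraction R (G k) k.+1 x).

Definition model_space (E F : hilbertType R) (G : nat -> hilbertType R) :=
  dsum (dsum (hardy E) (hardy F)) (hsum (fun k => copies (G k) k.+1)).

Definition model_operator (E F : hilbertType R) (G : nat -> hilbertType R) :
    model_space E F G -> model_space E F G :=
  dsum_op (dsum_op (@mulz R E) (adjoint (@mulz R F))) (@truncated_shifts G).

End ReducingSubspaces.

(* Main.v *)
Require Import Defs.
From mathcomp Require Import all_boot all_order all_algebra.
From mathcomp Require Import finmap complex.
From mathcomp Require Import boolp classical_sets functions cardinality reals.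
From mathcomp Require Import topology normedtype sequences.
From mathcomp Require Import summability.
Set Implicit Arguments.
Unset Strict Implicit.
Unset Printing Implicit Defensive.
Import Order.TTheory GRing.Theory Num.Theory.
Import numFieldNormedType.Exports.
Local Open Scope classical_set_scope.
Local Open Scope ring_scope.

(** Split the model space into slots: a slot is a Taylor coefficient of the
    first or of the second Hardy summand, or one of the k + 1 copies of G k in
    the summand of index k. On coordinates, T and its adjoint T^* only move
    slots, so each slot s has a number p(s) of predecessors and a number q(s) of
    successors along T:
    - the n-th coefficient in the first Hardy space has p = n, q = infinity;
    - the n-th coefficient in the second one has p = infinity, q = n;
    - the i-th copy of G k has p = i, q = k - i.
    The pair (p, q) determines the slot. Now T^a T^*^a is the projection onto the
    slots with p >= a, and T^*^b T^b the projection onto those with q >= b.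
    Differences of consecutive ones project onto the slots with p = a, or with
    q = b (exactly_behind and exactly_ahead), and they map a reducing subspace M
    into itself.

    The product of two such projections isolates any slot of a truncated shift
    (exactly_behind_ahead), so M contains those components of its elements
    (reducing_embJ). The projection onto p = n leaves the n-th coefficient of the
    first Hardy space together with slots of truncated shifts, whose components
    are already known to lie in M. As M is closed it contains their sum
    (closed_subspace_model), hence the Hardy component as well (reducing_embE);
    the second Hardy space is symmetric (reducing_embF).

    So M consists of all x whose slot components lie in M. Powers of T and T^*
    carry the contents of one slot to every other slot of the same Hardy space,
    or of the same copies of G k, so the condition on a component is the same
    for all of these (reducing_eq_coord_sub). It remains to see that for a closed
    subspace S of E an element of H^2_E takes its values in S exactly when its
    Taylor coefficients belong to S (hardy_sub_taylorP). *)

(** * Closed subspaces *)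

Section ClosedSubspace.
Variable R : realType.
Local Notation C := R[i].

Lemma closed_approxP (V : normedModType C) (S : set V) :
  closed S <->
  (forall x, (forall e : C, 0 < e -> exists2 s, S s & `|x - s| < e) -> S x).
Proof.
split=> [Sc x xS|Sx x xS].
  apply: Sc => B /nbhs_ballP[e /= e0 eB].
  have [s Ss xs] := xS e e0; exists s; split => //.
  by apply: eB; rewrite -ball_normE.
apply: Sx => e e0; have [s [Ss]] := xS _ (nbhsx_ballx x e e0).
by rewrite -ball_normE; exists s.
Qed.

Lemma closed_subspace_preimage (U V : hilbertType R) (f : U -> V) (M : set V) :
  linear f -> (forall x, `|f x| <= `|x|) -> closed_subspace M ->
  closed_subspace (f @^-1` M).
Proof.
move=> flin f1 [Mc M0 MD MZ].
have fD x y : f (x + y) = f x + f y by rewrite -[x]scale1r flin !scale1r.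
have f0 : f 0 = 0 by apply: (addrI (f 0)); rewrite -fD !addr0.
have fZ a x : f (a *: x) = a *: f x by rewrite -[a *: x]addr0 flin f0 addr0.
have fB x y : f x - f y = f (x - y) by rewrite -scaleN1r -fZ -fD scaleN1r.
split => [||x y Mx My|a x Mx] /=; first last.
- by rewrite fZ; exact: MZ.
- by rewrite fD; exact: MD.
- by rewrite /preimage/= f0.
apply/closed_approxP => x xM; move/closed_approxP : Mc; apply => e e0.
have [s Ms xs] := xM e e0; exists (f s) => //.
by rewrite fB (le_lt_trans (f1 _)).
Qed.

Lemma closed_subspaceB (V : hilbertType R) (M : set V) x y :
  closed_subspace M -> M x -> M y -> M (x - y).
Proof. by move=> [_ _ MD MZ] Mx My; rewrite -scaleN1r; apply: MD => //; exact: MZ. Qed.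

Lemma closed_subspace_sum (V : hilbertType R) (M : set V) (I : Type)
    (r : seq I) (f : I -> V) :
  closed_subspace M -> (forall i, M (f i)) -> M (\sum_(i <- r) f i).
Proof. by move=> [_ M0 MD _] Mf; elim/big_ind: _. Qed.

Lemma closed_subspace_forall (V : hilbertType R) (I : Type)
    (M : I -> set V) :
  (forall i, closed_subspace (M i)) -> closed_subspace [set x | forall i, M i x].
Proof.
move=> Mi; split=> [|i|x y Mx My i|a x Mx i].
- apply/closed_approxP => x xM i; have [/closed_approxP Mc _ _ _] := Mi i.
  apply: Mc => e e0; have [s Ms xs] := xM e e0; exists s => //; exact: Ms.
- by have [_ M0 _ _] := Mi i.
- by have [_ _ MD _] := Mi i; exact: MD.
- by have [_ _ _ MZ] := Mi i; exact: MZ.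
Qed.

Lemma closed_subspaceI (V : hilbertType R) (M N : set V) :
  closed_subspace M -> closed_subspace N -> closed_subspace (M `&` N).
Proof.
move=> Msub Nsub; rewrite (_ : M `&` N = [set x | forall b, (if b then M else N) x]).
  by apply: closed_subspace_forall => -[].
apply/seteqP; split=> x /=; first by move=> [Mx Nx] [].
by move=> MN; split; [exact: (MN true) | exact: (MN false)].
Qed.

End ClosedSubspace.

(** * Adjoints of direct sums and of truncated shifts *)

Section Adjoint.
Variable R : realType.
Local Notation C := R[i].

Lemma inner_conj (V : hilbertType R) (x y : V) : inner x y = (inner y x)^*.
Proof. by rewrite [LHS]hermC/= expr0 mul1r. Qed.

Lemma adjoint_eq (V : hilbertType R) (A B : V -> V) :
  (forall x y, inner (A x) y = inner x (B y)) -> adjoint A = B.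
Proof.
move=> AB; have adjP x y : inner (A x) y = inner x (adjoint A y).
  by rewrite /adjoint; case: xgetP => [D _ /(_ x y)//|/(_ B)].
apply/funext => y; apply/eqP; rewrite -subr_eq0 -(dnorm_eq0 inner).
by rewrite linearBr/= -AB -adjP subrr.
Qed.

Lemma adjoint_sym (V : hilbertType R) (A B : V -> V) :
  (forall x y, inner (A x) y = inner x (B y)) ->
  forall x y, inner (B x) y = inner x (A y).
Proof. by move=> AB x y; rewrite inner_conj -AB -inner_conj. Qed.

(** |B x|^2 = <A B x, x> <= |B x| |x|. It provides the bound that hsum_op asks of
    the adjoints of the truncated shifts. *)
Lemma adjoint_contraction (V : hilbertType R) (A B : V -> V) :
  (forall x y, inner (A x) y = inner x (B y)) ->
  (forall x, `|A x| <= `|x|) -> forall x, `|B x| <= `|x|.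
Proof.
move=> AB A1 x; have [->|Bx0] := eqVneq (B x) 0; first by rewrite normr0.
have Bx : 0 < `|B x| by rewrite normr_gt0.
rewrite -(ler_pM2l Bx) -expr2 -inner_norm -AB.
rewrite -[leLHS]ger0_norm; last by rewrite AB inner_norm exprn_ge0.
by rewrite (le_trans (inner_cauchy_schwarz _ _))// ler_wpM2r.
Qed.

Lemma eq_inner_hsum (I : choiceType) (V : I -> hilbertType R)
    (x y x' y' : hsum V) :
  (forall i, inner (x i) (y i) = inner (x' i) (y' i)) ->
  inner x y = inner x' y'.
Proof.
move=> xy; apply: hsum_innerE; have /(congr1 partial_sum) -> :
    (fun i => inner (x i) (y i) : C^o) = (fun i => inner (x' i) (y' i) : C^o).
  by apply/funext => i; rewrite xy.
exact: hsum_inner_cvg.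
Qed.

Lemma hsum_op_adjoint (I : choiceType) (V : I -> hilbertType R)
    (A B : forall i, V i -> V i)
    (A1 : forall i x, `|A i x| <= `|x|) (B1 : forall i x, `|B i x| <= `|x|) :
  (forall i x y, inner (A i x) y = inner x (B i y)) ->
  forall x y, inner (hsum_op A1 x) y = inner x (hsum_op B1 y).
Proof. by move=> AB x y; apply: eq_inner_hsum => i /=. Qed.

Lemma dsum_op_adjoint (U W : hilbertType R) (A A' : U -> U) (B B' : W -> W) :
  (forall x y, inner (A x) y = inner x (A' y)) ->
  (forall x y, inner (B x) y = inner x (B' y)) ->
  forall x y, inner (dsum_op A B x) y = inner x (dsum_op A' B' y).
Proof. by move=> AA BB x y; apply: eq_inner_hsum => -[] /=. Qed.

Lemma inner_hsum_fin (I : finType) (V : I -> hilbertType R) (x y : hsum V) :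
  inner x y = \sum_i inner (x i) (y i).
Proof.
apply: hsum_innerE; apply: cvg_near_cst.
exists [fset i in I]%fset => // A /= IA; rewrite -partial_sum_fin.
congr (partial_sum _ _); apply/eqP; rewrite eqEfsubset IA andbT.
by apply/fsubsetP => i _; rewrite !inE.
Qed.

Lemma inner_l2_cvg (E : hilbertType R) (x y : hsum (fun _ : nat => E)) :
  series (fun n => inner (x n) (y n) : C^o) @ \oo --> (inner x y : C^o).
Proof.
rewrite (_ : series _ =
    partial_sum (fun n => inner (x n) (y n) : C^o) \o initial).
  exact: cvg_comp (@cvg_initial) (hsum_inner_cvg x y).
by apply/funext => n /=; rewrite partial_sum_initial.
Qed.

Definition truncated_bshift (E : hilbertType R) (k : nat) (x : copies E k) :
    copies E k :=
  hsum_fin (fun i : 'I_k => if i.+1 == k then 0 : E else x (ordS i)).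

(** The cyclic successor on the indices turns one sum into the other; the last
    index, which it sends to 0, contributes 0 on both sides. *)
Lemma truncated_shift_adjoint (E : hilbertType R) k (x y : copies E k) :
  inner (truncated_shift x) y = inner x (truncated_bshift y).
Proof.
rewrite !inner_hsum_fin (reindex (@ordS k)); last first.
  by apply: onW_bij; exact: ordS_bij.
apply: eq_bigr => i _ /=; rewrite ordSK.
have := ltn_ord i; rewrite leq_eqVlt => /orP[/eqP ik|ik].
  by rewrite ik modnn !eqxx linear0l linear0r.
by rewrite modn_small// (ltn_eqF ik).
Qed.

Lemma truncated_bshift_contraction (E : hilbertType R) k (x : copies E k) :
  `|truncated_bshift x| <= `|x|.
Proof.
apply: adjoint_contraction x; first exact: truncated_shift_adjoint.
exact: truncated_shift_contraction.
Qed.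

End Adjoint.

(** * Finitely supported vectors in a direct sum *)

Section Single.
Variables (R : realType) (I : choiceType) (V : I -> hilbertType R).
Local Notation C := R[i].

Lemma sum_fset_if_eq (U : zmodType) (A : {fset I}) i (c : U) :
  \sum_(j <- A) (if j == i then c else 0) = if i \in A then c else 0.
Proof.
case: ifPn => iA.
  rewrite (bigD1_seq i)//= ?fset_uniq// eqxx big1 ?addr0// => j.
  by move=> /negPf->.
by rewrite big1_seq// => j /= jA; case: eqP => // ji; rewrite -ji jA in iA.
Qed.

Lemma partial_sum_single_le i (v : V i) (A : {fset I}) :
  partial_sum (fun j => `|dfwith (fun j => 0 : V j) v j| ^+ 2) A <= `|v| ^+ 2.
Proof.
apply: le_trans (_ : partial_sum (fun j => if j == i then `|v| ^+ 2 else 0) A <= _).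
  2: by rewrite partial_sum_fsetE sum_fset_if_eq; case: ifP => // _; exact: exprn_ge0.
apply: ler_sum => j _; case: ifPn => [/eqP->|ji]; first by rewrite dfwith_in.
by rewrite dfwith_out 1?eq_sym// normr0 expr0n.
Qed.

Definition hsum_single i (v : V i) : hsum V :=
  HSum (ex_intro _ _ (partial_sum_single_le v)).
Arguments hsum_single : clear implicits.

Lemma hsum_single_in i (v : V i) : hsum_single i v i = v.
Proof. exact: dfwith_in. Qed.

Lemma hsum_single_out i (v : V i) j : j != i -> hsum_single i v j = 0.
Proof. by move=> ji; rewrite /= dfwith_out// eq_sym. Qed.

Lemma hsum_single_linear i : linear (hsum_single i).
Proof.
move=> a v w; apply: hsum_ext => j /=.
have [<-|ji] := eqVneq i j; first by rewrite !dfwith_in.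
by rewrite !dfwith_out// scaler0 addr0.
Qed.

Lemma norm_hsum_single_le i (v : V i) : `|hsum_single i v| <= `|v|.
Proof. by apply: hsum_norm_le => // A; exact: partial_sum_single_le. Qed.

Lemma hsum_sum_coord (J : Type) (r : seq J) (f : J -> hsum V) i :
  (\sum_(j <- r) f j) i = \sum_(j <- r) f j i.
Proof. exact: (big_morph (fun x : hsum V => x i)). Qed.

(** The truncations of x to finite sets A of indices lie in N and converge to x:
    the squared norm of the remainder is |x|^2 minus the partial sum over A. *)
Lemma closed_subspace_hsum_single (N : set (hsum V)) (x : hsum V) :
  closed_subspace N -> (forall i, N (hsum_single i (x i))) -> N x.
Proof.
move=> Nsub Nx; have [/closed_approxP Nc _ _ _] := Nsub; apply: Nc => e e0.
have e20 : 0 < e ^+ 2 by rewrite exprn_gt0.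
have /cvgrPdist_lt/(_ _ e20)[A _ /(_ A (fsubset_refl A))] := hsum_inner_cvg x x.
have -> : partial_sum (fun i => inner (x i) (x i) : C^o) A =
    partial_sum (fun i => `|x i| ^+ 2 : C) A.
  by apply: eq_bigr => i _; exact: inner_norm.
rewrite -hsum_normE; set S := partial_sum _; set d := _ - _.
have d0 : 0 <= d by rewrite subr_ge0; exact: hsum_norm_ge.
rewrite ger0_norm// => de.
(* A is chosen so that d = |x|^2 - \sum_(i in A) |x_i|^2 < e^2. *)
exists (\sum_(i <- A) hsum_single i (x i)); first exact: closed_subspace_sum.
pose y : hsum V := x - \sum_(i <- A) hsum_single i (x i).
have yE i : y i = if i \in A then 0 else x i.
  have -> : y i = x i - (\sum_(i <- A) hsum_single i (x i)) i by [].
  rewrite hsum_sum_coord.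
  rewrite (eq_bigr (fun j => if j == i then x i else 0)); last first.
    move=> j _; have [->|ji] := eqVneq j i; first by rewrite hsum_single_in.
    by rewrite hsum_single_out// eq_sym.
  by rewrite sum_fset_if_eq; case: ifP => _; rewrite ?subrr ?subr0.
have yx : x - \sum_(i <- A) hsum_single i (x i) = y by [].
rewrite yx {yx}; clearbody y.
have yd : `|y| <= sqrtC d.
  apply: hsum_norm_le => [|B]; first by rewrite sqrtC_ge0.
  rewrite sqrtCK; pose AB := (A `|` B)%fset.
  have y0 i : 0 <= `|y i| ^+ 2 by exact: exprn_ge0.
  (* Enlarging B to contain A makes the sum of |y_i|^2 a difference of partial
     sums of |x_i|^2, since y vanishes on A and agrees with x elsewhere. *)
  apply: le_trans (partial_sum_le y0 (fsubsetUr A B)) _.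
  rewrite -[leLHS]subr0.
  have <- : partial_sum (fun i => `|y i| ^+ 2) A = 0.
    rewrite partial_sum_fsetE big1_seq// => i /= iA.
    by rewrite yE iA normr0 expr0n.
  rewrite partial_sum_sub ?fsubsetUl// partial_sum_fsetE.
  rewrite (eq_big_seq (fun i => `|x i| ^+ 2)); last first.
    by move=> i; rewrite inE => /andP[/negPf iA _]; rewrite yE iA.
  rewrite -partial_sum_fsetE -partial_sum_sub ?fsubsetUl// lerD2r.
  exact: hsum_norm_ge.
apply: le_lt_trans yd _.
by rewrite -(@ltr_pXn2r _ 2)// ?nnegrE ?sqrtC_ge0// ?sqrtCK// ltW.
Qed.

Lemma closed_subspace_single (i : I) (N : set (hsum V)) :
  closed_subspace N -> closed_subspace (hsum_single i @^-1` N).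
Proof.
apply: closed_subspace_preimage; first exact: hsum_single_linear.
exact: norm_hsum_single_le.
Qed.

End Single.
Arguments hsum_single {R I V} i v.

(** * The Hardy space through Taylor coefficients *)

Section BackwardShift.
Variables (R : realType) (E : hilbertType R).
Local Notation C := R[i].
Local Notation l2 := (hsum (fun _ : nat => E)).
Implicit Types (a : l2) (f g : hardy E).

Lemma bshift_square_summable a :
  @square_summable R nat (fun=> E) (fun n => a n.+1).
Proof.
have [M aM] := hsumP a; exists M => A; pose N := \max_(i <- A) i.
have AN : (A `<=` initial N.+1)%fset by exact: sub_initial.
apply: le_trans (partial_sum_le _ AN) _ => [i|]; first by rewrite exprn_ge0.
apply: le_trans (aM (initial N.+2)).
rewrite !partial_sum_initial /series/= [leRHS]big_nat_recl//=.
by rewrite lerDr exprn_ge0.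
Qed.

Definition bshift a : l2 := HSum (bshift_square_summable a).

Definition hardy_bshift f : hardy E := hardy_of (bshift (taylor f)).

Lemma taylor_mulz f : taylor (mulz f) = Defs.shift (taylor f).
Proof. by apply: taylor_unique; exact: power_series_of_shift (taylorP f). Qed.

Lemma taylor_bshift f : taylor (hardy_bshift f) = bshift (taylor f).
Proof. exact: hardy_ofK. Qed.

Lemma mulz_adjoint f g : inner (mulz f) g = inner f (hardy_bshift g).
Proof.
have innerE (h k : hardy E) : inner h k = inner (taylor h) (taylor k) by [].
rewrite !innerE taylor_mulz taylor_bshift.
have := @inner_l2_cvg _ _ (Defs.shift (taylor f)) (taylor g); rewrite -cvg_shiftS.
rewrite (_ : (fun n => _) = series (fun n =>
    inner (taylor f n) (bshift (taylor g) n) : C^o)); last first.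
  by apply/funext => N; rewrite /series/= big_nat_recl//= linear0l add0r.
by move=> h; apply: cvg_unique h (@inner_l2_cvg _ _ _ _).
Qed.

(** Each Taylor coefficient is at most |f|, so the power series is dominated by a
    geometric series. *)
Lemma norm_hardy_le f z : `|f z| <= (1 - `|val z|)^-1 * `|f|.
Proof.
apply: (@complex_cvg_le R nat \oo
  (fun N => `|series (fun n => val z ^+ n *: taylor f n) N|)).
  by apply: cvg_norm; exact: taylorP.
near=> N; apply: le_trans (ler_norm_sum _ _ _) _ => /=.
apply: le_trans (_ : (\sum_(0 <= n < N) `|val z| ^+ n) * `|f| <= _).
  rewrite mulr_suml; apply: ler_sum => n _.
  rewrite normrZ normrX ler_wpM2l ?exprn_ge0// -norm_taylor.
  exact: hsum_coord_le.
rewrite ler_wpM2r//.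
have := @partial_sum_geometric R `|val z| (initial N) (normr_ge0 _) (valP z).
by rewrite partial_sum_initial.
Unshelve. all: by end_near. Qed.

Lemma hardy_bshiftE f z : f z = taylor f 0 + val z *: hardy_bshift f z.
Proof.
pose sf := series (fun n => val z ^+ n *: taylor f n).
have fz : (fun N => sf N.+1) @ \oo --> f z by rewrite cvg_shiftS; exact: taylorP.
have bz := taylorP (hardy_bshift f) z; rewrite taylor_bshift in bz.
suff gz : (fun N => sf N.+1) @ \oo -->
    taylor f 0 + val z *: hardy_bshift f z by exact: cvg_unique fz gz.
have -> : (fun N => sf N.+1) = cst (taylor f 0) \+
    (val z \*: series (fun n => val z ^+ n *: bshift (taylor f) n)).
  apply/funext => N; rewrite /sf /series/= big_nat_recl//= expr0 scale1r.
  congr +%R; rewrite scaler_sumr; apply: eq_bigr => n _.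
  by rewrite scalerA exprS.
by apply: cvgD; [exact: cvg_cst|apply: cvgZl_tmp].
Qed.

(** The backward shift of f is (f z - f 0) / z away from 0, hence S-valued there.
    At 0 its value is the limit of its values at small nonzero points, and S is
    closed. Iterating yields all Taylor coefficients of f. *)
Lemma hardy_sub_bshift (S : set E) f :
  closed_subspace S -> hardy_sub S f ->
  S (taylor f 0) /\ hardy_sub S (hardy_bshift f).
Proof.
move=> Ssub Sf; have [Sc _ _ SZ] := Ssub.
have disc0 : `|0 : C| < 1 by rewrite normr0.
pose z0 : disc R := exist (fun z : C => `|z| < 1) 0 disc0.
have f0 g : g z0 = taylor g 0.
  by rewrite [LHS]hardy_bshiftE/= scale0r addr0.
have S0 : S (taylor f 0) by rewrite -f0; exact: Sf.
split=> // z; set g := hardy_bshift f.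
have Sg w : val w != 0 -> S (g w).
  move=> w0; have -> : g w = (val w)^-1 *: (f w - taylor f 0).
    by rewrite [f w]hardy_bshiftE addrAC subrr add0r scalerA mulVf// scale1r.
  by apply: SZ; exact: closed_subspaceB.
have [z_eq0|] := eqVneq (val z) 0; last exact: Sg.
have -> : z = z0 by apply: val_inj.
move/closed_approxP : Sc; apply => e e0.
(* With g z = g 0 + z h z and |h t| <= |h| / (1 - t) <= 2 |h| for t <= 1/2, the
   point t = e / d gives |g 0 - g t| <= 2 t |h| < e; the summand e of d / 2
   ensures t <= 1/2. *)
pose h := hardy_bshift g; pose d := 2 * (`|h| + 1 + e).
have d0 : 0 < d by rewrite mulr_gt0// ltr_wpDl// addr_ge0.
pose t := e / d; have t0 : 0 < t by rewrite divr_gt0.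
have t12 : t <= 2^-1.
  by rewrite ler_pdivrMr// mulKf ?pnatr_eq0// lerDr addr_ge0//.
have t1 : `|t| < 1.
  by rewrite gtr0_norm// (le_lt_trans t12)// invf_lt1// (ltr_nat C 1 2).
pose w : disc R := exist (fun z : C => `|z| < 1) t t1.
exists (g w); first by apply: Sg; rewrite gt_eqF.
have wE : val w = t by [].
rewrite f0 hardy_bshiftE opprD addrA subrr add0r normrN normrZ wE gtr0_norm//.
apply: le_lt_trans (_ : _ <= t * (2 * `|h|)) _.
  rewrite ler_pM2l// (le_trans (norm_hardy_le _ _))// ler_wpM2r//=.
  rewrite gtr0_norm// -[leRHS]invrK lef_pV2 ?posrE ?invr_gt0 ?subr_gt0//; last first.
    by rewrite -(gtr0_norm t0).
  rewrite lerBrDr -lerBrDl; apply: le_trans t12 _.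
  by rewrite {2}[1](splitr 1) div1r addrK.
rewrite /t -mulrA -[ltRHS]mulr1 ltr_pM2l// mulrC ltr_pdivrMr// mul1r ltr_pM2l//.
by rewrite -addrA ltrDl addr_gt0.
Qed.

End BackwardShift.

Section HardySub.
Variables (R : realType) (E : hilbertType R).

Lemma hardy_sub_taylorP (S : set E) (f : hardy E) : closed_subspace S ->
  hardy_sub S f <-> forall n, S (taylor f n).
Proof.
move=> Ssub; split=> [Sf n|Sf z].
  elim: n f Sf => [|n IH] f Sf; have [S0 Sb] := hardy_sub_bshift Ssub Sf => //.
  by have := IH _ Sb; rewrite taylor_bshift.
have [Sc _ _ SZ] := Ssub.
apply: (closed_cvg S Sc _ _ (@taylorP _ _ f z)); apply: nearW => N.
by apply: closed_subspace_sum => // n; exact: SZ.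
Qed.

End HardySub.

Section HardyOf.
Variables (R : realType) (E : hilbertType R).
Local Notation l2 := (hsum (fun _ : nat => E)).

Lemma hardy_of_linear : linear (@hardy_of R E).
Proof. by move=> k a b; apply: taylor_inj; rewrite linearP/= !hardy_ofK. Qed.

Lemma norm_hardy_of (a : l2) : `|hardy_of a| = `|a|.
Proof. by rewrite -norm_taylor hardy_ofK. Qed.

Lemma closed_subspace_hardy (N : set (hardy E)) (f : hardy E) :
  closed_subspace N ->
  (forall n, N (hardy_of (@hsum_single _ _ (fun=> E) n (taylor f n)))) -> N f.
Proof.
move=> Nsub Nf; have -> : f = hardy_of (taylor f).
  by apply: taylor_inj; rewrite hardy_ofK.
have Tsub : closed_subspace ((@hardy_of R E : l2 -> hardy E) @^-1` N).
  apply: closed_subspace_preimage Nsub; first exact: hardy_of_linear.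
  by move=> a; rewrite norm_hardy_of.
exact: (closed_subspace_hsum_single Tsub).
Qed.

End HardyOf.

(** * Coordinates on the model space *)

Section Model.
Variables (R : realType) (E F : hilbertType R) (G : nat -> hilbertType R).
Local Notation H := (model_space E F G).
Local Notation T := (@model_operator R E F G).
Implicit Types x y : H.

Definition adjoint_truncated_shifts :=
  hsum_op (fun k (x : copies (G k) k.+1) => truncated_bshift_contraction x).

Definition model_adjoint : H -> H :=
  dsum_op (dsum_op (@hardy_bshift R E) (@mulz R F)) adjoint_truncated_shifts.

Lemma adjoint_mulz (K : hilbertType R) : adjoint (@mulz R K) = @hardy_bshift R K.
Proof. by apply: adjoint_eq; exact: mulz_adjoint. Qed.

Lemma adjoint_model_operator : adjoint T = model_adjoint.
Proof.
apply: adjoint_eq; rewrite /model_operator adjoint_mulz.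
apply: dsum_op_adjoint; last first.
  by apply: hsum_op_adjoint => k; exact: truncated_shift_adjoint.
apply: dsum_op_adjoint; first exact: mulz_adjoint.
by apply: adjoint_sym; exact: mulz_adjoint.
Qed.

(** The third family of coordinates takes any natural number as index and is 0
    beyond k: the adjoint then acts on it by i |-> i.+1 without a side
    condition. *)
Definition coordE x n : E := taylor (x true true) n.
Definition coordF x n : F := taylor (x true false) n.
Definition coordJ x k (i : nat) : G k :=
  if insub i is Some j then x false k j else 0.

Lemma coordJ_ord x k (i : 'I_k.+1) : coordJ x k i = x false k i.
Proof. by rewrite /coordJ valK. Qed.

Lemma coordJ_out x k i : (k < i)%N -> coordJ x k i = 0.
Proof. by move=> ki; rewrite /coordJ insubF// ltnS leqNgt ki. Qed.

Lemma coordEB x y n : coordE (x - y) n = coordE x n - coordE y n.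
Proof. by rewrite /coordE linearB. Qed.

Lemma coordFB x y n : coordF (x - y) n = coordF x n - coordF y n.
Proof. by rewrite /coordF linearB. Qed.

Lemma coordJB x y k i : coordJ (x - y) k i = coordJ x k i - coordJ y k i.
Proof. by rewrite /coordJ; case: insub => [j|]; rewrite ?subrr. Qed.

Lemma model_ext x y : (forall n, coordE x n = coordE y n) ->
  (forall n, coordF x n = coordF y n) ->
  (forall k i, coordJ x k i = coordJ y k i) -> x = y.
Proof.
move=> xyE xyF xyJ; apply: hsum_ext => -[].
  by apply: hsum_ext => -[]; apply: taylor_inj; apply: hsum_ext.
apply: hsum_ext => k; apply: hsum_ext => i.
by have := xyJ k i; rewrite !coordJ_ord.
Qed.

Lemma coordE_op x n : coordE (T x) n = if n is m.+1 then coordE x m else 0.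
Proof. by rewrite /coordE taylor_mulz. Qed.

Lemma coordF_op x n : coordF (T x) n = coordF x n.+1.
Proof. by rewrite /coordF/= adjoint_mulz taylor_bshift. Qed.

Lemma coordJ_op x k i : coordJ (T x) k i =
  if i is j.+1 then if (j < k)%N then coordJ x k j else 0 else 0.
Proof.
have [ki|ik] := ltnP k i.
  rewrite coordJ_out//; case: i ki => // j; rewrite ltnS => kj.
  by rewrite ltnNge kj.
rewrite -ltnS in ik; rewrite (coordJ_ord _ (Ordinal ik))/=.
case: i ik => // j jk /=; rewrite -ltnS jk -(coordJ_ord x (ord_pred _))/=.
by rewrite modnDr modn_small// ltnW.
Qed.

Lemma coordE_adj x n : coordE (model_adjoint x) n = coordE x n.+1.
Proof. by rewrite /coordE taylor_bshift. Qed.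

Lemma coordF_adj x n :
  coordF (model_adjoint x) n = if n is m.+1 then coordF x m else 0.
Proof. by rewrite /coordF taylor_mulz. Qed.

Lemma coordJ_adj x k i : coordJ (model_adjoint x) k i = coordJ x k i.+1.
Proof.
have [ki|ik] := ltnP k i; first by rewrite !coordJ_out// ltnW.
rewrite -ltnS in ik; rewrite (coordJ_ord _ (Ordinal ik))/= eqSS.
case: ifPn => [/eqP ki|ki]; first by rewrite coordJ_out// ki.
have jk : (i < k)%N by rewrite ltn_neqAle ki -ltnS.
by rewrite -(coordJ_ord x (ordS _))/= modn_small.
Qed.

Lemma coordE_iter_op a x n :
  coordE (iter a T x) n = if (a <= n)%N then coordE x (n - a)%N else 0.
Proof.
by elim: a n => [|a IH] [|n]; rewrite ?coordE_op ?subn0//= IH ltnS subSS.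
Qed.

Lemma coordF_iter_op a x n : coordF (iter a T x) n = coordF x (n + a)%N.
Proof.
by elim: a n => [|a IH] n; rewrite ?coordF_op ?addn0//= IH addSnnS.
Qed.

Lemma coordJ_iter_op a x k i : coordJ (iter a T x) k i =
  if (a <= i <= k)%N then coordJ x k (i - a)%N else 0.
Proof.
elim: a i => [|a IH] i /=.
  by rewrite subn0; case: leqP => // ki; rewrite coordJ_out.
rewrite coordJ_op; case: i => [//|i]; rewrite IH ltnS subSS.
by case: (ltnP i k) => [ik|]; rewrite ?andbF// (ltnW ik).
Qed.

Lemma coordE_iter_adj a x n : coordE (iter a model_adjoint x) n = coordE x (n + a)%N.
Proof.
by elim: a n => [|a IH] n; rewrite ?coordE_adj ?addn0//= IH addSnnS.
Qed.

Lemma coordF_iter_adj a x n : coordF (iter a model_adjoint x) n =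
  if (a <= n)%N then coordF x (n - a)%N else 0.
Proof.
by elim: a n => [|a IH] [|n]; rewrite ?coordF_adj ?subn0//= IH ltnS subSS.
Qed.

Lemma coordJ_iter_adj a x k i :
  coordJ (iter a model_adjoint x) k i = coordJ x k (i + a)%N.
Proof.
by elim: a i => [|a IH] i; rewrite ?coordJ_adj ?addn0//= IH addSnnS.
Qed.

Lemma coordE_linear n : linear (coordE^~ n).
Proof. by move=> a x y; rewrite /coordE/= linearP. Qed.

Lemma coordF_linear n : linear (coordF^~ n).
Proof. by move=> a x y; rewrite /coordF/= linearP. Qed.

Lemma coordJ_linear k i : linear (fun x : H => coordJ x k i).
Proof.
by move=> a x y; rewrite /coordJ; case: insub => //; rewrite scaler0 addr0.
Qed.

Lemma norm_coordE_le n x : `|coordE x n| <= `|x|.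
Proof.
apply: le_trans (hsum_coord_le x true); apply: le_trans (hsum_coord_le _ true).
by rewrite -norm_taylor; exact: hsum_coord_le.
Qed.

Lemma norm_coordF_le n x : `|coordF x n| <= `|x|.
Proof.
apply: le_trans (hsum_coord_le x true); apply: le_trans (hsum_coord_le _ false).
by rewrite -norm_taylor; exact: hsum_coord_le.
Qed.

Lemma norm_coordJ_le k i x : `|coordJ x k i| <= `|x|.
Proof.
rewrite /coordJ; case: insub => [j|]; last by rewrite normr0.
apply: le_trans (hsum_coord_le x false); apply: le_trans (hsum_coord_le _ k).
exact: hsum_coord_le.
Qed.

Definition embE n (v : E) : H :=
  @hsum_single _ _ (dsum_family _ _) true
    (@hsum_single _ _ (dsum_family _ _) true (hardy_of (hsum_single n v))).
Definition embF n (v : F) : H :=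
  @hsum_single _ _ (dsum_family _ _) true
    (@hsum_single _ _ (dsum_family _ _) false (hardy_of (hsum_single n v))).
Definition embJ k (i : 'I_k.+1) (v : G k) : H :=
  @hsum_single _ _ (dsum_family _ _) false
    (@hsum_single _ _ (fun k => copies (G k) k.+1) k
      (@hsum_single _ _ (fun=> G k) i v)).

Lemma hsum_single_const (K : hilbertType R) (I : choiceType) (i : I) (v : K) j :
  @hsum_single _ _ (fun=> K) i v j = if j == i then v else 0.
Proof.
by case: eqVneq => [->|ji]; rewrite ?hsum_single_in ?hsum_single_out.
Qed.

Lemma coordE_embE n v m : coordE (embE n v) m = if m == n then v else 0.
Proof.
by rewrite /coordE /embE !hsum_single_in hardy_ofK hsum_single_const.
Qed.

Lemma coordF_embE n v m : coordF (embE n v) m = 0.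
Proof. by rewrite /coordF /embE hsum_single_in hsum_single_out// linear0. Qed.

Lemma coordJ_embE n v k i : coordJ (embE n v) k i = 0.
Proof.
by rewrite /coordJ /embE; case: insub => // j; rewrite hsum_single_out.
Qed.

Lemma coordE_embF n v m : coordE (embF n v) m = 0.
Proof. by rewrite /coordE /embF hsum_single_in hsum_single_out// linear0. Qed.

Lemma coordF_embF n v m : coordF (embF n v) m = if m == n then v else 0.
Proof.
by rewrite /coordF /embF !hsum_single_in hardy_ofK hsum_single_const.
Qed.

Lemma coordJ_embF n v k i : coordJ (embF n v) k i = 0.
Proof.
by rewrite /coordJ /embF; case: insub => // j; rewrite hsum_single_out.
Qed.

Lemma coordE_embJ k (i : 'I_k.+1) (v : G k) n : coordE (embJ i v) n = 0.
Proof. by rewrite /coordE /embJ hsum_single_out// linear0. Qed.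

Lemma coordF_embJ k (i : 'I_k.+1) (v : G k) n : coordF (embJ i v) n = 0.
Proof. by rewrite /coordF /embJ hsum_single_out// linear0. Qed.

Lemma coordJ_embJ k (i : 'I_k.+1) (v : G k) j :
  coordJ (embJ i v) k j = if j == i then v else 0.
Proof.
rewrite /coordJ /embJ hsum_single_in; case: insubP => [l _ <-|kj].
  by rewrite hsum_single_in hsum_single_const.
by case: eqP kj => // ->; rewrite ltn_ord.
Qed.

Lemma coordJ_embJ_out k (i : 'I_k.+1) (v : G k) l j :
  l != k -> coordJ (embJ i v) l j = 0.
Proof.
move=> lk; rewrite /coordJ /embJ hsum_single_in; case: insub => // m.
by rewrite hsum_single_out.
Qed.

Lemma embE_linear n : linear (embE n).
Proof.
move=> a v w; rewrite /embE -hsum_single_linear; congr hsum_single.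
rewrite -hsum_single_linear; congr hsum_single.
by rewrite -hardy_of_linear -hsum_single_linear.
Qed.

Lemma embF_linear n : linear (embF n).
Proof.
move=> a v w; rewrite /embF -hsum_single_linear; congr hsum_single.
rewrite -hsum_single_linear; congr hsum_single.
by rewrite -hardy_of_linear -hsum_single_linear.
Qed.

Lemma embJ_linear k (i : 'I_k.+1) : linear (embJ i).
Proof.
move=> a v w; rewrite /embJ -hsum_single_linear; congr hsum_single.
rewrite -hsum_single_linear; congr hsum_single.
by rewrite -hsum_single_linear.
Qed.

Lemma norm_embE_le n v : `|embE n v| <= `|v|.
Proof.
apply: le_trans (norm_hsum_single_le _) _.
apply: le_trans (norm_hsum_single_le _) _ => /=.
by rewrite norm_hardy_of norm_hsum_single_le.
Qed.

Lemma norm_embF_le n v : `|embF n v| <= `|v|.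
Proof.
apply: le_trans (norm_hsum_single_le _) _.
apply: le_trans (norm_hsum_single_le _) _ => /=.
by rewrite norm_hardy_of norm_hsum_single_le.
Qed.

Lemma norm_embJ_le k (i : 'I_k.+1) v : `|embJ i v| <= `|v|.
Proof.
apply: le_trans (norm_hsum_single_le _) _.
apply: le_trans (norm_hsum_single_le _) _ => /=.
exact: norm_hsum_single_le.
Qed.

(** The slots span a dense subspace. The density of finitely supported vectors is
    applied level by level through the nested direct sums, each time to the
    preimage of M under the embedding of a summand. *)
Lemma closed_subspace_model (M : set H) x : closed_subspace M ->
  (forall n, M (embE n (coordE x n))) ->
  (forall n, M (embF n (coordF x n))) ->
  (forall k (i : 'I_k.+1), M (embJ i (coordJ x k i))) -> M x.
Proof.
move=> Msub ME MF MJ.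
apply: (closed_subspace_hsum_single Msub) => b.
have {}Msub := closed_subspace_single b Msub; case: b Msub => Msub.
  apply: (closed_subspace_hsum_single Msub) => b.
  have {}Msub := closed_subspace_single b Msub; case: b Msub => Msub.
    by apply: (closed_subspace_hardy Msub) => n; exact: ME.
  by apply: (closed_subspace_hardy Msub) => n; exact: MF.
apply: (closed_subspace_hsum_single Msub) => k.
have {}Msub := closed_subspace_single k Msub.
apply: (closed_subspace_hsum_single Msub) => i.
by have := MJ k i; rewrite coordJ_ord.
Qed.

(** * Projections built from powers of the operator and its adjoint *)

(** Projections onto the slots with at least, or exactly, the given number of
    slots before them (behind) or after them (ahead) along T. *)
Definition behind a x := iter a T (iter a model_adjoint x).
Definition ahead b x := iter b model_adjoint (iter b T x).
Definition exactly_behind a x := behind a x - behind a.+1 x.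
Definition exactly_ahead b x := ahead b x - ahead b.+1 x.

Lemma coordE_exactly_behind p x n :
  coordE (exactly_behind p x) n = if n == p then coordE x n else 0.
Proof.
rewrite coordEB !coordE_iter_op !coordE_iter_adj.
case: (ltngtP p n) => pn; rewrite ?subr0//; last by rewrite subnK// pn.
by rewrite !subnK ?subrr// ltnW.
Qed.

Lemma coordF_exactly_behind p x n : coordF (exactly_behind p x) n = 0.
Proof.
by rewrite coordFB !coordF_iter_op !coordF_iter_adj !leq_addl !addnK subrr.
Qed.

Lemma coordJ_exactly_behind p x k i :
  coordJ (exactly_behind p x) k i = if i == p then coordJ x k i else 0.
Proof.
rewrite coordJB !coordJ_iter_op !coordJ_iter_adj.
have [ki|ik] := ltnP k i.
  by rewrite !andbF subrr coordJ_out// if_same.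
rewrite !andbT; case: (ltngtP p i) => pi; rewrite ?subr0//.
  by rewrite !subnK ?subrr// ltnW.
by rewrite subnK// pi.
Qed.

Lemma coordE_exactly_ahead q x n : coordE (exactly_ahead q x) n = 0.
Proof.
by rewrite coordEB !coordE_iter_adj !coordE_iter_op !leq_addl !addnK subrr.
Qed.

Lemma coordF_exactly_ahead q x n :
  coordF (exactly_ahead q x) n = if n == q then coordF x n else 0.
Proof.
rewrite coordFB !coordF_iter_adj !coordF_iter_op.
case: (ltngtP q n) => qn; rewrite ?subr0//; last by rewrite subnK// qn.
by rewrite !subnK ?subrr// ltnW.
Qed.

Lemma coordJ_exactly_ahead q x k i :
  coordJ (exactly_ahead q x) k i = if (i + q)%N == k then coordJ x k i else 0.
Proof.
rewrite coordJB !coordJ_iter_adj !coordJ_iter_op !leq_addl !addnK/= addnS.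
by case: (ltngtP (i + q)%N k) => _; rewrite ?subrr ?subr0.
Qed.

(** The i-th copy of G k is the only slot with i predecessors and k - i
    successors; Hardy slots have infinitely many of one or the other. *)
Lemma exactly_behind_ahead x k (i : 'I_k.+1) :
  exactly_behind i (exactly_ahead (k - i) x) = embJ i (coordJ x k i).
Proof.
have ik : (i <= k)%N by rewrite -ltnS.
apply: model_ext => [n|n|l j].
- by rewrite coordE_exactly_behind coordE_exactly_ahead coordE_embJ if_same.
- by rewrite coordF_exactly_behind coordF_embJ.
rewrite coordJ_exactly_behind coordJ_exactly_ahead; have [->|lk] := eqVneq l k.
  by rewrite coordJ_embJ; case: eqP => // ->; rewrite subnKC// eqxx.
rewrite coordJ_embJ_out//; case: eqP => // ->.
by rewrite subnKC// eq_sym (negPf lk).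
Qed.

(** * Reducing subspaces *)

Definition coord_sub (E0 : set E) (F0 : set F) (S : forall k, set (G k)) :
    set H :=
  [set x | forall n, E0 (coordE x n)] `&` [set x | forall n, F0 (coordF x n)] `&`
  [set x | forall k i, S k (coordJ x k i)].

Section CoordSub.
Variables (E0 : set E) (F0 : set F) (S : forall k, set (G k)).
Arguments S : clear implicits.
Hypotheses (E0sub : closed_subspace E0) (F0sub : closed_subspace F0)
  (Ssub : forall k, closed_subspace (S k)).

Lemma closed_subspace_coord_sub : closed_subspace (coord_sub E0 F0 S).
Proof.
apply: closed_subspaceI; first apply: closed_subspaceI.
- apply: (@closed_subspace_forall _ _ _ (fun n => coordE^~ n @^-1` E0)).
  move=> n; apply: closed_subspace_preimage E0sub; first exact: coordE_linear.
  exact: norm_coordE_le.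
- apply: (@closed_subspace_forall _ _ _ (fun n => coordF^~ n @^-1` F0)).
  move=> n; apply: closed_subspace_preimage F0sub; first exact: coordF_linear.
  exact: norm_coordF_le.
apply: (@closed_subspace_forall _ _ _ (fun k =>
  [set x : H | forall i, S k (coordJ x k i)])) => k.
apply: (@closed_subspace_forall _ _ _ (fun i =>
  (fun x : H => coordJ x k i) @^-1` S k)) => i.
apply: closed_subspace_preimage (Ssub k); first exact: coordJ_linear.
exact: norm_coordJ_le.
Qed.

Lemma reducing_coord_sub : reducing_subspace T (coord_sub E0 F0 S).
Proof.
have [[_ E00 _ _] [_ F00 _ _]] := (E0sub, F0sub).
have S0 k : S k 0 by have [] := Ssub k.
split=> [|x [[xE xF] xJ]|x [[xE xF] xJ]]; first exact: closed_subspace_coord_sub.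
  split; [split=> n|move=> k i].
  - by rewrite coordE_op; case: n.
  - by rewrite coordF_op.
  - by rewrite coordJ_op; case: i => // i; case: ifP.
rewrite adjoint_model_operator; split; [split=> n|move=> k i].
- by rewrite coordE_adj.
- by rewrite coordF_adj; case: n.
- by rewrite coordJ_adj.
Qed.

Lemma model_sub_coord_sub :
  dsum_sub (dsum_sub (hardy_sub E0) (hardy_sub F0))
    (hsum_sub (fun k => hsum_sub (fun _ : 'I_k.+1 => S k))) = coord_sub E0 F0 S.
Proof.
have S0 k : S k 0 by have [] := Ssub k.
apply/seteqP; split=> x.
  move=> [[/(hardy_sub_taylorP _ E0sub) xE /(hardy_sub_taylorP _ F0sub) xF] xJ].
  split=> // k i; rewrite /coordJ; case: insub => // j; exact: xJ.
move=> [[xE xF] xJ]; split; first split.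
- exact/(hardy_sub_taylorP _ E0sub).
- exact/(hardy_sub_taylorP _ F0sub).
- by move=> k i; have := xJ k i; rewrite coordJ_ord.
Qed.

End CoordSub.

Section Reducing.
Variable M : set H.
Hypothesis Mred : reducing_subspace T M.
Let Msub : closed_subspace M. Proof. by have [] := Mred. Qed.

Lemma reducing_iter_op a x : M x -> M (iter a T x).
Proof. by have [_ MT _] := Mred => Mx; elim: a => //= a; exact: MT. Qed.

Lemma reducing_iter_adj a x : M x -> M (iter a model_adjoint x).
Proof.
have [_ _ MT] := Mred => Mx; elim: a => //= a.
by rewrite -adjoint_model_operator; exact: MT.
Qed.

Lemma reducing_behind p x : M x -> M (exactly_behind p x).
Proof.
by move=> Mx; apply: closed_subspaceB => //; apply: reducing_iter_op;
  exact: reducing_iter_adj.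
Qed.

Lemma reducing_ahead q x : M x -> M (exactly_ahead q x).
Proof.
by move=> Mx; apply: closed_subspaceB => //; apply: reducing_iter_adj;
  exact: reducing_iter_op.
Qed.

Lemma reducing_embJ k (i : 'I_k.+1) x : M x -> M (embJ i (coordJ x k i)).
Proof.
by move=> Mx; rewrite -exactly_behind_ahead; apply: reducing_behind;
  exact: reducing_ahead.
Qed.

Lemma closed_subspace_embE n : closed_subspace (embE n @^-1` M).
Proof.
apply: closed_subspace_preimage Msub; first exact: embE_linear.
exact: norm_embE_le.
Qed.

Lemma closed_subspace_embF n : closed_subspace (embF n @^-1` M).
Proof.
apply: closed_subspace_preimage Msub; first exact: embF_linear.
exact: norm_embF_le.
Qed.

Lemma closed_subspace_embJ k (i : 'I_k.+1) :
  closed_subspace (embJ i @^-1` M).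
Proof.
apply: closed_subspace_preimage Msub; first exact: embJ_linear.
exact: norm_embJ_le.
Qed.

(** The projection onto the slots with n predecessors splits into the wanted
    component and components in copies of the spaces G k; the latter form an
    element of M by density. *)
Lemma reducing_embE n x : M x -> M (embE n (coordE x n)).
Proof.
move=> Mx; have My : M (exactly_behind n x) by exact: reducing_behind.
rewrite -[embE _ _](subKr (exactly_behind n x)).
apply: closed_subspaceB => //; apply: closed_subspace_model => // [m|m|k i].
- rewrite coordEB coordE_exactly_behind coordE_embE.
  have [_ M0 _ _] := closed_subspace_embE m.
  by case: eqVneq => [<-|_]; rewrite subrr; exact: M0.
- rewrite coordFB coordF_exactly_behind coordF_embE subrr.
  by have [] := closed_subspace_embF m.
by rewrite coordJB coordJ_embE subr0; exact: reducing_embJ.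
Qed.

Lemma reducing_embF n x : M x -> M (embF n (coordF x n)).
Proof.
move=> Mx; have My : M (exactly_ahead n x) by exact: reducing_ahead.
rewrite -[embF _ _](subKr (exactly_ahead n x)).
apply: closed_subspaceB => //; apply: closed_subspace_model => // [m|m|k i].
- rewrite coordEB coordE_exactly_ahead coordE_embF subrr.
  by have [] := closed_subspace_embE m.
- rewrite coordFB coordF_exactly_ahead coordF_embF.
  have [_ M0 _ _] := closed_subspace_embF m.
  by case: eqVneq => [<-|_]; rewrite subrr; exact: M0.
by rewrite coordJB coordJ_embF subr0; exact: reducing_embJ.
Qed.

Lemma reducing_eq_coord_sub :
  exists (E0 : set E) (F0 : set F) (S : forall k, set (G k)),
    [/\ closed_subspace E0, closed_subspace F0,
        (forall k, closed_subspace (S k)) & M = coord_sub E0 F0 S].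
Proof.
(* Requiring membership in every slot makes these sets closed subspaces as
   intersections of preimages of M. *)
exists [set v | forall n, M (embE n v)], [set v | forall n, M (embF n v)],
  (fun k => [set v | forall i : 'I_k.+1, M (embJ i v)]).
have Ssub k : closed_subspace [set v | forall i : 'I_k.+1, M (embJ i v)].
  by apply: closed_subspace_forall => i; exact: closed_subspace_embJ.
split=> //; [exact: (closed_subspace_forall closed_subspace_embE)
  |exact: (closed_subspace_forall closed_subspace_embF)|].
apply/seteqP; split=> x; last first.
  move=> [[xE xF] xJ]; apply: closed_subspace_model => // [n|n|k i].
  - exact: xE.
  - exact: xF.
  - exact: xJ.
move=> Mx; split; [split=> n m|move=> k i j].
(* The component of x in slot n is moved to slot m by powers of T and T^*. *)
- have -> : coordE x n = coordE (iter m T (iter n model_adjoint x)) m.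
    by rewrite coordE_iter_op leqnn subnn coordE_iter_adj.
  by apply/reducing_embE/reducing_iter_op/reducing_iter_adj.
- have -> : coordF x n = coordF (iter m model_adjoint (iter n T x)) m.
    by rewrite coordF_iter_adj leqnn subnn coordF_iter_op.
  by apply/reducing_embF/reducing_iter_adj/reducing_iter_op.
have -> : coordJ x k i = coordJ (iter j T (iter i model_adjoint x)) k j.
  by rewrite coordJ_iter_op leqnn -ltnS ltn_ord subnn coordJ_iter_adj.
by apply/reducing_embJ/reducing_iter_op/reducing_iter_adj.
Qed.

End Reducing.
End Model.

Theorem theorem3p2 (R : realType) (E F : hilbertType R)
    (G : nat -> hilbertType R)
    (sepE : separable E) (sepF : separable F)
    (sepG : forall k, separable (G k))
    (M : set (model_space E F G)) :
  reducing_subspace (@model_operator R E F G) M <->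
  exists (E0 : set E) (F0 : set F) (S : forall k, set (G k)),
    [/\ closed_subspace E0, closed_subspace F0,
        (forall k, closed_subspace (S k)) &
        M = dsum_sub (dsum_sub (hardy_sub E0) (hardy_sub F0))
              (hsum_sub (fun k => hsum_sub (fun _ : 'I_k.+1 => S k)))].
Proof.
split=> [/reducing_eq_coord_sub|] [E0 [F0 [S [E0sub F0sub Ssub ->]]]].
  by exists E0, F0, S; split=> //; rewrite model_sub_coord_sub.
by rewrite model_sub_coord_sub//; exact: reducing_coord_sub.
Qed.
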